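(* Let $(\Bbbk,\mathbb{A},\kappa)$ be a smooth deformation of a smooth manifold $\mathcal{M}$, and let $(\Omega^1,d)$ be a deformation of $1$-forms for it. Then $(\Omega^1,d)$ determines a contravariant connection $\mathcal{D}$ on $T^*\mathcal{M}$, namely the one with $\mathcal{D}_{df}\sigma=\{f,\sigma\}$ for all $f\in C^\infty_{\mathrm c}(\mathcal{M})$ and $\sigma\in\Omega^1_{\mathrm c}(\mathcal{M})$, and $\mathcal{D}$ is both flat and torsion-free.
   Context: Functions, forms and sections are $\mathbb{C}$-valued (bundles are complexified where necessary); $C^\infty_{\mathrm c}$, $\Omega^1_{\mathrm c}$, $\Gamma_{\mathrm c}$ denote compactly supported smooth functions, $1$-forms, sections. Smooth deformation (to second order) of $\mathcal{M}$: a commutative (unital) $\mathbb{C}$-algebra $\Bbbk$, an associative (possibly nonunital, noncommutative) $\Bbbk$-algebra $\mathbb{A}$, an element $\kappa\in\Bbbk$, and an algebra isomorphism $C^\infty_{\mathrm c}(\mathcal{M})\cong\mathbb{A}/\kappa\mathbb{A}$, such that $\mathbb{A}/\kappa^3\mathbb{A}$ is a free $\mathbb{C}[\kappa]/\kappa^3$-module. Poisson structure: for $f=a\bmod\kappa$, $g=b\bmod\kappa$ in $C^\infty_{\mathrm c}(\mathcal{M})$, $\{f,g\}\in C^\infty_{\mathrm c}(\mathcal{M})$ is the unique function with $\kappa\{f,g\}=i(ab-ba)\bmod\kappa^2$. This is a Poisson bracket, so $\{f,g\}=\pi^{ij}\,df_i\,dg_j$ for a (possibly complex-valued) Poisson bivector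 field $\pi$. Define $\#$ from $1$-forms to vector fields by $(\#\sigma)^j=\pi^{ij}\sigma_i$. The Koszul bracket $[\cdot,\cdot]_\pi$ is the antisymmetric bracket of $1$-forms determined by $[df,dg]_\pi=d\{f,g\}$ and $[\sigma,f\rho]_\pi=\#\sigma(f)\,\rho+f[\sigma,\rho]_\pi$. Bimodule deformation of a vector bundle $V\to\mathcal{M}$: an $\mathbb{A}$-bimodule $\mathbb{V}$ (compatible with a $\Bbbk$-module structure, $\Bbbk$ acting the same way on both sides) with a $C^\infty_{\mathrm c}(\mathcal{M})$-bimodule isomorphism $\Gamma_{\mathrm c}(\mathcal{M},V)\cong\mathbb{V}/\kappa\mathbb{V}$ (left and right multiplication of functions on sections being the same), such that $\mathbb{V}/\kappa^3\mathbb{V}$ is a free $\mathbb{C}[\kappa]/\kappa^3$-module. The generalized Poisson bracket of $f=a\bmod\kappa\in C^\infty_{\mathrm c}(\mathcal{M})$ and $v=\hat v\bmod\kappa\in\Gamma_{\mathrm c}(\mathcal{M},V)$ is the unique section $\{f,v\}\in\Gamma_{\mathrm c}(\mathcal{M},V)$ with $\kappa\{f,v\}=i(a\hat v-\hat v a)\bmod\kappa^2$. Deformation of $1$-forms: a bimodule deformation $\Omega^1$ of $T^*\mathcal{M}$ together with a $\Bbbk$-linear derivation $d:\mathbb{A}\to\Omega^1$, $d(ab)=da\,b+a\,db$, which reduces modulo $\kappa$ to the gradient operator $d:C^\infty_{\mathrm c}(\mathcal{M})\to\Omega^1_{\mathrm c}(\mathcal{M})$. Contravariant connection on $V$: a linear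 map $\sigma\mapsto\mathcal{D}_\sigma$ from $1$-forms to first order differential operators on $V$ with $\mathcal{D}_{f\sigma}v=f\mathcal{D}_\sigma v$ and $\mathcal{D}_\sigma(fv)=\#\sigma(f)\,v+f\mathcal{D}_\sigma v$. Its curvature is $K(\sigma,\rho)v=\mathcal{D}_\sigma\mathcal{D}_\rho v-\mathcal{D}_\rho\mathcal{D}_\sigma v-\mathcal{D}_{[\sigma,\rho]_\pi}v$; it is flat if $K=0$. When $V=T^*\mathcal{M}$, its torsion is $T(\sigma,\rho)=\mathcal{D}_\sigma\rho-\mathcal{D}_\rho\sigma-[\sigma,\rho]_\pi$; it is torsion-free if $T=0$. *)

(* Defs.v *)
From HB Require Import structures.
From mathcomp Require Import all_boot all_order all_algebra.
From mathcomp Require Import all_classical all_reals all_analysis.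
From mathcomp Require Import complex.
Set Implicit Arguments.
Unset Strict Implicit.
Unset Printing Implicit Defensive.
Import Order.TTheory GRing.Theory Num.Theory.
Import numFieldNormedType.Exports.
Local Open Scope classical_set_scope.
Local Open Scope ring_scope.

Section SmoothRn.
Context {R : realType} {n : nat}.

Definition partial {W : normedModType R} (i : 'I_n) (f : 'rV[R]_n -> W)
    : 'rV[R]_n -> W :=
  fun x => 'D_(delta_mx 0 i) f x.

(* [diff_upto k U f]: the partial derivatives of [f] of order at most [k] exist
   and are Frechet differentiable on the open set [U]. *)
Fixpoint diff_upto {W : normedModType R} (k : nat) (U : set 'rV[R]_n)
    (f : 'rV[R]_n -> W) : Prop :=
  (forall x, U x -> differentiable f x) /\
  (if k is k'.+1 then forall i, diff_upto k' U (partial i f) else True).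

Definition smooth_on {W : normedModType R} (U : set 'rV[R]_n)
    (f : 'rV[R]_n -> W) : Prop :=
  forall k, diff_upto k U f.

Definition csmooth_on (U : set 'rV[R]_n) (f : 'rV[R]_n -> R[i]) : Prop :=
  smooth_on U (fun x => complex.Re (f x)) /\
  smooth_on U (fun x => complex.Im (f x)).

Definition cpartial (i : 'I_n) (f : 'rV[R]_n -> R[i]) (x : 'rV[R]_n) : R[i] :=
  Complex (partial i (fun y => complex.Re (f y)) x)
          (partial i (fun y => complex.Im (f y)) x).

Section Closure.
Variable U : set 'rV[R]_n.
Hypothesis oU : open U.

Lemma near_differentiable (W : normedModType R) (f g : 'rV[R]_n -> W) x :
  (\near x, f x = g x) -> differentiable f x -> differentiable g x.
Proof.
move=> fg df; have fgx : f x = g x by exact: nbhs_singleton fg.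
have /diff_locallyP[cdf edf] := df.
have egf : g \o shift x = cst (g x) + 'd f x +o_ 0 id.
  apply/eqaddoP => e e0; have /eqaddoP/(_ e e0) := edf.
  have := fg; rewrite (near_shift 0) subr0 => fg0.
  move=> small; near=> y.
  have -> : (g \o shift x - (cst (g x) + 'd f x)) y =
            (f \o shift x - (cst (f x) + 'd f x)) y.
    by rewrite !fctE /= -fgx; congr (_ - _); apply/esym; near: y.
  by near: y.
have dgE := diff_unique cdf egf.
by apply/diff_locallyP; rewrite dgE.
Unshelve. all: by end_near. Qed.

Lemma near_open (W : Type) (f g : 'rV[R]_n -> W) x :
  {in U, f =1 g} -> U x -> \near x, f x = g x.
Proof.
move=> fg Ux; apply: filterS (open_nbhs_nbhs (conj oU Ux)) => y Uy.
by apply: fg; rewrite inE.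
Qed.

Lemma diff_upto_eq (W : normedModType R) k (f g : 'rV[R]_n -> W) :
  {in U, f =1 g} -> diff_upto k U f -> diff_upto k U g.
Proof.
elim: k f g => [|k IH] f g fg /= [df sf]; split=> //.
- by move=> x Ux; exact: near_differentiable (near_open fg Ux) (df x Ux).
- by move=> x Ux; exact: near_differentiable (near_open fg Ux) (df x Ux).
move=> i; apply: IH (sf i) => x /[!inE] Ux.
exact: near_eq_derive (near_open fg Ux).
Qed.

Lemma diff_upto_cst (W : normedModType R) k (c : W) :
  diff_upto k U (fun=> c).
Proof.
elim: k c => [|k IH] c; split=> // i.
apply: (diff_upto_eq (f := fun=> 0)) => // x _.
by rewrite /partial derive_cst.
Qed.

Lemma diff_upto_le (W : normedModType R) k (f : 'rV[R]_n -> W) :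
  diff_upto k.+1 U f -> diff_upto k U f.
Proof.
elim: k f => [|k IH] f /= [df sf]; split=> // i.
exact: IH (sf i).
Qed.

Lemma diff_uptoD (W : normedModType R) k (f g : 'rV[R]_n -> W) :
  diff_upto k U f -> diff_upto k U g -> diff_upto k U (fun x => f x + g x).
Proof.
elim: k f g => [|k IH] f g /= [df sf] [dg sg]; split=> //.
- by move=> x Ux; exact: differentiableD (df x Ux) (dg x Ux).
- by move=> x Ux; exact: differentiableD (df x Ux) (dg x Ux).
move=> i; apply: diff_upto_eq (IH _ _ (sf i) (sg i)) => x /[!inE] Ux.
by rewrite /partial [RHS]deriveD //; apply: diff_derivable; auto.
Qed.

Lemma diff_uptoN (W : normedModType R) k (f : 'rV[R]_n -> W) :
  diff_upto k U f -> diff_upto k U (fun x => - f x).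
Proof.
elim: k f => [|k IH] f /= [df sf]; split=> //.
- by move=> x Ux; exact: differentiableN (df x Ux).
- by move=> x Ux; exact: differentiableN (df x Ux).
move=> i; apply: diff_upto_eq (IH _ (sf i)) => x /[!inE] Ux.
by rewrite /partial [RHS]deriveN //; apply: diff_derivable; auto.
Qed.

Lemma diff_uptoM k (f g : 'rV[R]_n -> R) :
  diff_upto k U f -> diff_upto k U g -> diff_upto k U (fun x => f x * g x).
Proof.
elim: k f g => [|k IH] f g.
  move=> /= [df _] [dg _]; split=> // x Ux.
  exact: differentiableM (df x Ux) (dg x Ux).
move=> sf sg; have [df pf] := sf; have [dg pg] := sg; split=> [x Ux|i].
  exact: differentiableM (df x Ux) (dg x Ux).
have := diff_uptoD (IH _ _ (diff_upto_le sf) (pg i))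
                   (IH _ _ (diff_upto_le sg) (pf i)).
apply: diff_upto_eq => x /[!inE] Ux.
by rewrite /partial [RHS]deriveM //; apply: diff_derivable; auto.
Qed.

Lemma csmooth_on_eq (f g : 'rV[R]_n -> R[i]) :
  {in U, f =1 g} -> csmooth_on U f -> csmooth_on U g.
Proof.
move=> fg [sr si].
by split=> k; [move: (sr k)|move: (si k)]; apply: diff_upto_eq => x Ux; rewrite fg.
Qed.

Lemma csmooth_on_cst (c : R[i]) : csmooth_on U (fun=> c).
Proof. by split=> k; apply: diff_upto_cst. Qed.

Lemma csmooth_onD (f g : 'rV[R]_n -> R[i]) : csmooth_on U f ->
  csmooth_on U g -> csmooth_on U (fun x => f x + g x).
Proof.
move=> [fr fi] [gr gi]; split=> k.
  by apply: diff_upto_eq (diff_uptoD (fr k) (gr k)) => x _; case: (f x) (g x) => [? ?] [].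
by apply: diff_upto_eq (diff_uptoD (fi k) (gi k)) => x _; case: (f x) (g x) => [? ?] [].
Qed.

Lemma csmooth_onN (f : 'rV[R]_n -> R[i]) : csmooth_on U f ->
  csmooth_on U (fun x => - f x).
Proof.
move=> [fr fi]; split=> k.
  by apply: diff_upto_eq (diff_uptoN (fr k)) => x _; case: (f x).
by apply: diff_upto_eq (diff_uptoN (fi k)) => x _; case: (f x).
Qed.

Lemma csmooth_onM (f g : 'rV[R]_n -> R[i]) : csmooth_on U f ->
  csmooth_on U g -> csmooth_on U (fun x => f x * g x).
Proof.
move=> [fr fi] [gr gi]; split=> k.
  apply: diff_upto_eq (diff_uptoD (diff_uptoM (fr k) (gr k))
    (diff_uptoN (diff_uptoM (fi k) (gi k)))) => x _.
  by case: (f x) (g x) => [? ?] [].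
apply: diff_upto_eq (diff_uptoD (diff_uptoM (fr k) (gi k))
  (diff_uptoM (fi k) (gr k))) => x _.
by case: (f x) (g x) => [? ?] [].
Qed.

Lemma csmooth_on_sum (I : finType) (F : I -> 'rV[R]_n -> R[i]) :
  (forall i, csmooth_on U (F i)) -> csmooth_on U (fun x => \sum_i F i x).
Proof.
move=> sF; elim: (index_enum I) => [|i r IH].
  by apply: csmooth_on_eq (csmooth_on_cst 0) => x _; rewrite big_nil.
by apply: csmooth_on_eq (csmooth_onD (sF i) IH) => x _; rewrite big_cons.
Qed.

Lemma csmooth_on_cpartial i (f : 'rV[R]_n -> R[i]) :
  csmooth_on U f -> csmooth_on U (cpartial i f).
Proof.
by move=> [fr fi]; split=> k; [have [_] := fr k.+1|have [_] := fi k.+1]; apply.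
Qed.

End Closure.
End SmoothRn.

(* Hausdorff, second countable manifold of constant dimension, given by a
   smooth atlas indexed by [chart]. [cmap a] and [cinv a] are total functions
   of which only the restrictions to [cdom a] and [cran a] matter. *)
Record smooth_manifold (R : realType) := SmoothManifold {
  carrier :> topologicalType;
  mdim : nat;
  chart : Type;
  cdom : chart -> set carrier;
  cmap : chart -> carrier -> 'rV[R]_mdim;
  cinv : chart -> 'rV[R]_mdim -> carrier;
  cdom_open : forall a, open (cdom a);
  cran_open : forall a, open (cmap a @` cdom a);
  cmapK : forall a p, cdom a p -> cinv a (cmap a p) = p;
  cmap_continuous : forall a p, cdom a p -> {for p, continuous (cmap a)};
  cinv_continuous : forall a x, (cmap a @` cdom a) x ->
    {for x, continuous (cinv a)};
  chart_cover : forall p, exists a, cdom a p;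
  transition_smooth : forall a b,
    smooth_on (cmap a @` (cdom a `&` cdom b)) (cmap b \o cinv a);
  manifold_hausdorff : hausdorff_space carrier;
  manifold_second_countable : @second_countable carrier }.

Section Fields.
Context {R : realType} (M : smooth_manifold R).
Local Notation C := R[i].
Local Notation n := (mdim M).
Local Notation I := (chart M).
Implicit Types (a b : I) (p : M).

Definition cran a : set 'rV[R]_n := cmap a @` cdom a.

Definition smooth_in a (f : M -> C) : Prop := csmooth_on (cran a) (f \o cinv a).

(* entry (i, j) is the derivative of the [b]-coordinate j with respect to the
   [a]-coordinate i *)
Definition jac a b p : 'M[C]_n :=
  map_mx (real_complex R) ('J (cmap b \o cinv a) (cmap a p)).

Definition compactly_supported (nz : set M) : Prop := compact (closure nz).

Lemma smooth_in_eq a (f g : M -> C) :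
  (forall p, cdom a p -> f p = g p) -> smooth_in a f -> smooth_in a g.
Proof.
move=> fg; apply: csmooth_on_eq (@cran_open _ M a) _ _ _ => x.
by rewrite inE => -[p ap <-]; rewrite /= cmapK// fg.
Qed.

Definition smooth_pred : {pred M -> C} :=
  fun f => `[< forall a, smooth_in a f >].

Lemma smooth_predP (f : M -> C) :
  reflect (forall a, smooth_in a f) (f \in smooth_pred).
Proof. exact: asboolP. Qed.

Lemma smooth_pred_cst (c : C) : (fun=> c) \in smooth_pred.
Proof.
by apply/smooth_predP => a; exact: csmooth_on_cst (@cran_open _ M a) c.
Qed.

Lemma smooth_pred_subring : GRing.subring_closed smooth_pred.
Proof.
have oU a := @cran_open _ M a.
split=> [|f g /smooth_predP sf /smooth_predP sg|
          f g /smooth_predP sf /smooth_predP sg].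
- exact: smooth_pred_cst.
- apply/smooth_predP => a.
  exact: csmooth_onD (oU a) _ _ (sf a) (csmooth_onN (oU a) (sg a)).
- by apply/smooth_predP => a; exact: csmooth_onM (oU a) _ _ (sf a) (sg a).
Qed.
HB.instance Definition _ :=
  GRing.isSubringClosed.Build (M -> C) smooth_pred smooth_pred_subring.

(* C^oo(M), with complex values *)
Record smooth_fun := SmoothFun {
  smooth_fun_val :> M -> C;
  smooth_fun_valP : smooth_fun_val \in smooth_pred }.
HB.instance Definition _ := [isSub for smooth_fun_val].
HB.instance Definition _ := [Choice of smooth_fun by <:].
HB.instance Definition _ := [SubChoice_isSubZmodule of smooth_fun by <:].
HB.instance Definition _ := GRing.SubZmodule_isSubPzRing.Build (M -> C)
  smooth_pred smooth_fun smooth_pred_subring.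
HB.instance Definition _ := GRing.SubPzRing_isSubComPzRing.Build (M -> C)
  smooth_pred smooth_fun.

Definition csmooth_cst (c : C) : smooth_fun := SmoothFun (smooth_pred_cst c).

Definition csupp_fun (f : smooth_fun) : Prop :=
  compactly_supported [set p | f p != 0].

(* Local components in the chart [a] of a section of a tensor bundle, extended
   by 0 outside the domain of [a] so that equality of sections is equality of
   components. *)
Definition smooth_components (m k : nat) (T : I -> M -> 'M[C]_(m, k)) : Prop :=
  (forall a p, ~ cdom a p -> T a p = 0) /\
  (forall a i j, smooth_in a (fun p => T a p i j)).

Definition oneform_pred : {pred I -> M -> 'cV[C]_n} :=
  fun w => `[< smooth_components w /\
    (forall a b p, cdom a p -> cdom b p -> w a p = jac a b p *m w b p) >].

Lemma oneform_predP w : reflect (smooth_components w /\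
    (forall a b p, cdom a p -> cdom b p -> w a p = jac a b p *m w b p))
  (w \in oneform_pred).
Proof. exact: asboolP. Qed.

Lemma oneform_zmod_closed : GRing.zmod_closed oneform_pred.
Proof.
have oU a := @cran_open _ M a.
split=> [|v w /oneform_predP[[v0 sv] tv] /oneform_predP[[w0 sw] tw]];
  apply/oneform_predP.
- split; [split=> // a i j|by move=> a b p _ _; rewrite mulmx0].
  apply: (smooth_in_eq (f := fun=> 0)) => [p _|]; first by rewrite mxE.
  exact: csmooth_on_cst (oU a) 0.
- split; [split|].
  + by move=> a p ap; rewrite !fctE v0// w0// subr0.
  + move=> a i j.
    apply: (smooth_in_eq (f := fun p => v a p i j - w a p i j)) => [p _|].
      by rewrite !fctE !mxE.
    exact: csmooth_onD (oU a) _ _ (sv a i j) (csmooth_onN (oU a) (sw a i j)).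
  + by move=> a b p ap bp; rewrite !fctE mulmxBr -tv// -tw.
Qed.
HB.instance Definition _ := GRing.isZmodClosed.Build (I -> M -> 'cV[C]_n)
  oneform_pred oneform_zmod_closed.

(* smooth sections of the complexified cotangent bundle *)
Record oneform := OneForm {
  form_comp :> I -> M -> 'cV[C]_n;
  form_compP : form_comp \in oneform_pred }.
HB.instance Definition _ := [isSub for form_comp].
HB.instance Definition _ := [Choice of oneform by <:].
HB.instance Definition _ := [SubChoice_isSubZmodule of oneform by <:].

Lemma scale_form_subproof (f : smooth_fun) (w : oneform) :
  (fun a p => f p *: w a p) \in oneform_pred.
Proof.
have /oneform_predP[[w0 sw] tw] := form_compP w.
have /smooth_predP sf := smooth_fun_valP f.
apply/oneform_predP; split; [split|].
- by move=> a p ap; rewrite w0// scaler0.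
- move=> a i j.
  apply: (smooth_in_eq (f := fun p => f p * w a p i j)) => [p _|].
    by rewrite mxE.
  exact: csmooth_onM (@cran_open _ M a) _ _ (sf a) (sw a i j).
- by move=> a b p ap bp; rewrite -scalemxAr -tw.
Qed.

Definition scale_form f w : oneform := OneForm (scale_form_subproof f w).

Lemma oneformP (v w : oneform) : (forall a p, v a p = w a p) -> v = w.
Proof. by move=> vw; apply/val_inj/funext => a; apply/funext => p; apply: vw. Qed.

Fact scale_formA f g w : scale_form f (scale_form g w) = scale_form (f * g) w.
Proof. by apply/oneformP => a p; rewrite /= scalerA. Qed.
Fact scale_form1 : left_id 1 scale_form.
Proof. by move=> w; apply/oneformP => a p; rewrite /= scale1r. Qed.
Fact scale_formDr : right_distributive scale_form +%R.
Proof. by move=> f v w; apply/oneformP => a p; rewrite /= scalerDr. Qed.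
Fact scale_formDl w : {morph scale_form^~ w : f g / f + g}.
Proof. by move=> f g; apply/oneformP => a p; rewrite /= scalerDl. Qed.
HB.instance Definition _ := GRing.Zmodule_isLmodule.Build smooth_fun oneform
  scale_formA scale_form1 scale_formDr scale_formDl.

Definition csupp_form (w : oneform) : Prop :=
  compactly_supported [set p | exists a, w a p != 0].


Definition grad_comp (f : M -> C) a p : 'cV[C]_n :=
  if pselect (cdom a p) is left _
  then \col_i cpartial i (f \o cinv a) (cmap a p) else 0.

Lemma transition_differentiable a b p : cdom a p -> cdom b p ->
  differentiable (cmap b \o cinv a) (cmap a p).
Proof.
move=> ap bp; have [+ _] := @transition_smooth _ M a b 0%N.
by apply; exists p.
Qed.

Lemma near_transition (T : Type) (f : M -> T) a b p : cdom a p -> cdom b p ->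
  \forall x \near cmap a p,
    f (cinv a x) = f (cinv b ((cmap b \o cinv a) x)).
Proof.
move=> ap bp.
have ran : cran a (cmap a p) by exists p.
have bnbhs : nbhs (cinv a (cmap a p)) (cdom b).
  by rewrite cmapK//; exact: open_nbhs_nbhs (conj (@cdom_open _ M b) bp).
have : nbhs (cmap a p) (cinv a @^-1` cdom b) by exact: cinv_continuous bnbhs.
by apply: filterS => x /= bx; rewrite (cmapK bx).
Qed.

Lemma chain_rule a b p (g : 'rV[R]_n -> R) (f : M -> R) i :
  cdom a p -> cdom b p -> (forall x, g x = f (cinv b x)) ->
  differentiable g (cmap b p) ->
  partial i (fun x => f (cinv a x)) (cmap a p) =
  \sum_j ('J (cmap b \o cinv a) (cmap a p)) i j * partial j g (cmap b p).
Proof.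
move=> ap bp gE dg.
have dt := transition_differentiable ap bp.
have tE : (cmap b \o cinv a) (cmap a p) = cmap b p by rewrite /= cmapK.
rewrite -tE in dg.
rewrite /partial (near_eq_derive (g := g \o (cmap b \o cinv a))); last first.
  by apply: filterS (near_transition f ap bp) => x ->; rewrite /= gE.
rewrite deriveE; last exact: differentiable_comp.
rewrite diff_comp//= -[in LHS](mul_rV_lin1 ('d (cmap b \o cinv a) (cmap a p))).
rewrite tE -rowE in dg *.
rewrite [row i _]row_sum_delta linear_sum/=.
by apply: eq_bigr => j _; rewrite linearZ/= mxE cmapK// -deriveE.
Qed.

Lemma grad_subproof (f : smooth_fun) : grad_comp f \in oneform_pred.
Proof.
have /smooth_predP sf := smooth_fun_valP f.
apply/oneform_predP; split; [split|].
- by move=> a p ap; rewrite /grad_comp; case: pselect.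
- move=> a i j.
  apply: csmooth_on_eq (csmooth_on_cpartial i (sf a)).
    exact: cran_open.
  move=> x /[!inE] -[p ap <-] /=; rewrite cmapK// /grad_comp.
  by case: pselect => // _; rewrite mxE.
- move=> a b p ap bp; rewrite /grad_comp.
  case: pselect => // _; case: pselect => // _.
  have [/(_ 0%N)[dr _] /(_ 0%N)[di _]] := sf b.
  have ran : cran b (cmap b p) by exists p.
  apply/matrixP => i j; rewrite !mxE.
  under eq_bigr do rewrite !mxE.
  rewrite /cpartial.
  rewrite (chain_rule (f := fun q => complex.Re (f q)) i ap bp (fun=> erefl) (dr _ ran)).
  rewrite (chain_rule (f := fun q => complex.Im (f q)) i ap bp (fun=> erefl) (di _ ran)).
  rewrite /jacobian; under [X in Complex X _]eq_bigr do rewrite mxE.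
  under [X in Complex _ X]eq_bigr do rewrite mxE.
  elim/big_rec3: _ => [|k u v w _ <-]; first by [].
  by rewrite /=; congr Complex; rewrite /= ?mul0r ?subr0 ?addr0.
Qed.

(* the differential [df] *)
Definition grad (f : smooth_fun) : oneform := OneForm (grad_subproof f).

(* smooth sections of the complexified tangent bundle *)
Record vector_field := VectorField {
  vf_comp :> I -> M -> 'rV[C]_n;
  vf_smooth : smooth_components vf_comp;
  vf_transition : forall a b p, cdom a p -> cdom b p ->
    vf_comp b p = vf_comp a p *m jac a b p }.

(* contravariant antisymmetric 2-tensors pi^{ij} *)
Record bivector := Bivector {
  bv_comp :> I -> M -> 'M[C]_n;
  bv_antisym : forall a p, (bv_comp a p)^T = - bv_comp a p;
  bv_smooth : smooth_components bv_comp;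
  bv_transition : forall a b p, cdom a p -> cdom b p ->
    bv_comp b p = (jac a b p)^T *m bv_comp a p *m jac a b p }.

Definition chart_at (p : M) : I := projT1 (cid (chart_cover p)).

Lemma chart_atP p : cdom (chart_at p) p.
Proof. by rewrite /chart_at; case: cid. Qed.

Lemma pairing_subproof (X : vector_field) (w : oneform) :
  (fun p => (X (chart_at p) p *m w (chart_at p) p) 0 0) \in smooth_pred.
Proof.
have /oneform_predP[[w0 sw] tw] := form_compP w.
have [X0 sX] := vf_smooth X.
apply/smooth_predP => a.
apply: (smooth_in_eq (f := fun p => \sum_i X a p 0 i * w a p i 0)) => [p ap|].
  have cp := chart_atP p.
  by rewrite (tw (chart_at p) a)// mulmxA -vf_transition// mxE.
apply: (csmooth_on_sum (@cran_open _ M a)) => i.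
exact: csmooth_onM (@cran_open _ M a) _ _ (sX a 0 i) (sw a i 0).
Qed.

Definition pairing X w : smooth_fun := SmoothFun (pairing_subproof X w).

(* (#w)^j = pi^{ij} w_i *)
Definition sharp_comp (pi : bivector) (w : oneform) a p : 'rV[C]_n :=
  (w a p)^T *m pi a p.

Lemma sharp_smooth pi w : smooth_components (sharp_comp pi w).
Proof.
have /oneform_predP[[w0 sw] tw] := form_compP w.
have [pi0 spi] := bv_smooth pi.
split=> [a p ap|a i j]; first by rewrite /sharp_comp w0// trmx0 mul0mx.
apply: (smooth_in_eq (f := fun p => \sum_k w a p k 0 * pi a p k j)) => [p _|].
  by rewrite /sharp_comp !mxE; apply: eq_bigr => k _; rewrite mxE ord1.
apply: (csmooth_on_sum (@cran_open _ M a)) => k.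
exact: csmooth_onM (@cran_open _ M a) _ _ (sw a k 0) (spi a k j).
Qed.

Lemma sharp_transition pi (w : oneform) a b p : cdom a p -> cdom b p ->
  sharp_comp pi w b p = sharp_comp pi w a p *m jac a b p.
Proof.
have /oneform_predP[_ tw] := form_compP w.
move=> ap bp; rewrite /sharp_comp (tw a b)// (bv_transition _ ap bp).
by rewrite trmx_mul !mulmxA.
Qed.

Definition sharp (pi : bivector) (w : oneform) : vector_field :=
  VectorField (sharp_smooth pi w) (@sharp_transition pi w).

(* X(f) *)
Definition lie (X : vector_field) (f : smooth_fun) : smooth_fun :=
  pairing X (grad f).

(* pi^{ij} d_i f d_j g *)
Definition bv_bracket (pi : bivector) (f g : smooth_fun) : smooth_fun :=
  lie (sharp pi (grad f)) g.

Definition poisson (pi : bivector) : Prop := forall f g h,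
  bv_bracket pi f (bv_bracket pi g h) + bv_bracket pi g (bv_bracket pi h f)
    + bv_bracket pi h (bv_bracket pi f g) = 0.

Definition koszul_bracket (pi : bivector)
    (br : oneform -> oneform -> oneform) : Prop :=
  [/\ forall s r, br s r = - br r s,
      forall s r t, br s (r + t) = br s r + br s t,
      forall f g, br (grad f) (grad g) = grad (bv_bracket pi f g) &
      forall s f r, br s (f *: r) = lie (sharp pi s) f *: r + f *: br s r].

Section Connection.
Variable E : lmodType smooth_fun.

(* [E] is the module of smooth sections of a vector bundle; a C-linear [P] is
   a differential operator of order at most 1 iff [[P, f], g] = 0 for all f, g. *)
Definition first_order_diffop (P : E -> E) : Prop :=
  [/\ forall u v, P (u + v) = P u + P v,
      forall c v, P (csmooth_cst c *: v) = csmooth_cst c *: P v &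
      forall f g v,
        P (f *: (g *: v)) - f *: P (g *: v) - g *: P (f *: v)
          + f *: (g *: P v) = 0].

Definition contravariant_connection (pi : bivector) (D : oneform -> E -> E) :
    Prop :=
  [/\ forall s r v, D (s + r) v = D s v + D r v,
      forall s, first_order_diffop (D s),
      forall f s v, D (f *: s) v = f *: D s v &
      forall s f v, D s (f *: v) = lie (sharp pi s) f *: v + f *: D s v].

Definition curvature (br : oneform -> oneform -> oneform)
    (D : oneform -> E -> E) (s r : oneform) (v : E) : E :=
  D s (D r v) - D r (D s v) - D (br s r) v.

Definition flat (br : oneform -> oneform -> oneform) (D : oneform -> E -> E) :
    Prop :=
  forall s r v, curvature br D s r v = 0.

End Connection.

Definition torsion (br : oneform -> oneform -> oneform)
    (D : oneform -> oneform -> oneform) (s r : oneform) : oneform :=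
  D s r - D r s - br s r.

Definition torsion_free (br : oneform -> oneform -> oneform)
    (D : oneform -> oneform -> oneform) : Prop :=
  forall s r, torsion br D s r = 0.

End Fields.

(* [E / kap^3 E] is a free module over C[kap]/kap^3: [B] is a set of
   representatives of a basis, and a polynomial acts by evaluation at [kap]. *)
Definition free_mod_cube (C : fieldType) (k : comAlgType C) (E : lmodType k)
    (kap : k) : Prop :=
  exists B : set E,
    (forall x, exists (s : seq E) (c : E -> {poly C}) (y : E),
      [/\ uniq s, forall e, e \in s -> B e &
          x = \sum_(e <- s) horner_alg kap (c e) *: e + kap ^+ 3 *: y]) /\
    (forall (s : seq E) (c : E -> {poly C}) (y : E),
      uniq s -> (forall e, e \in s -> B e) ->
      \sum_(e <- s) horner_alg kap (c e) *: e = kap ^+ 3 *: y ->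
      forall e, e \in s -> ('X^3 %| c e)%R).

Lemma free_mod_cube_div (C : fieldType) (k : comAlgType C) (E : lmodType k)
    (kap : k) (x y : E) : free_mod_cube E kap ->
  kap *: x = kap ^+ 2 *: y -> exists z, x = kap *: z.
Proof.
move=> [B [span indep]] kxy.
have [s [c [t [us sB wE]]]] := span (x - kap *: y).
have kw : kap *: (x - kap *: y) = 0.
  by rewrite scalerBr kxy scalerA -expr2 subrr.
have Xc : forall e, e \in s -> ('X^3 %| 'X * c e)%R.
  apply: (indep s (fun e => 'X * c e) (- (kap *: t)) us sB).
  apply/eqP; rewrite scalerN -addr_eq0; apply/eqP.
  rewrite -[RHS]kw wE scalerDr scaler_sumr; congr (_ + _).
    by apply: eq_bigr => e _; rewrite rmorphM/= horner_algX scalerA.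
  by rewrite !scalerA mulrC.
pose q e := (c e %/ 'X^2)%R.
have cE : forall e, e \in s -> c e = q e * 'X^2.
  move=> e /Xc; rewrite exprS dvdp_mul2l ?polyX_eq0// => ?.
  by rewrite /q divpK.
exists (y + (\sum_(e <- s) horner_alg kap (q e * 'X) *: e + kap ^+ 2 *: t)).
rewrite scalerDr addrC -[LHS](subrK (kap *: y)) wE; congr (_ + _).
rewrite scalerDr scalerA -exprS; congr (_ + _).
rewrite scaler_sumr big_seq [RHS]big_seq; apply: eq_bigr => e es.
by rewrite scalerA cE// !rmorphM/= horner_algX mulrCA.
Qed.

Definition imul {R : rcfType} {k : comAlgType R[i]} {E : lmodType k} (x : E) : E :=
  ('i%C : R[i])%:A *: x.

(* The bracket induced by the commutator [cm a x] = a x - x a of an element of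
   the algebra [A] with an element of the bimodule [V] is well defined. *)
Lemma commutator_bracket (R : rcfType) (k : comAlgType R[i]) (kap : k)
    (A V : lmodType k) (S T : Type) (s : A -> S) (t : V -> T)
    (cm : A -> V -> V) :
  free_mod_cube V kap ->
  (forall a a', s a = s a' -> exists u, a = a' + kap *: u) ->
  (forall x x', t x = t x' <-> exists u, x = x' + kap *: u) ->
  (forall a a' x, cm (a + a') x = cm a x + cm a' x) ->
  (forall a x x', cm a (x + x') = cm a x + cm a x') ->
  (forall l a x, cm (l *: a) x = l *: cm a x) ->
  (forall l a x, cm a (l *: x) = l *: cm a x) ->
  (forall a x, exists y, cm a x = kap *: y) ->
  forall (a0 : A) (x0 : V),
  let P w := (exists y, t y = w) /\
    forall a x y, s a = s a0 -> t x = t x0 -> t y = w ->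
      exists z, kap *: y = imul (cm a x) + kap ^+ 2 *: z in
  exists w, unique P w.
Proof.
move=> fV ks kt cDl cDr cZl cZr cK a0 x0 P.
have [c cE] := cK a0 x0.
exists (t (imul c)); split.
  split; first by exists (imul c).
  move=> a x y /ks[u ->] /kt[v ->] /kt[w ->].
  have [d dE] := cK u (x0 + kap *: v); have [e eE] := cK a0 v.
  have -> : cm (a0 + kap *: u) (x0 + kap *: v) = kap *: c + kap ^+ 2 *: (e + d).
    by rewrite cDl cZl dE cDr cZr eE cE !scalerA -!expr2 -addrA -scalerDr.
  exists (w - imul (e + d)); rewrite /imul; move: (e + d) => ed; set j := _%:A.
  rewrite !scalerDr !scalerN !scalerA -expr2 ![j * _]mulrC -addrA; congr (_ + _).
  by rewrite addrC subrK.
move=> w' [[y' <-] /(_ a0 x0 y' erefl erefl erefl)[z zE]]; apply/kt.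
have [|z' z'E] := free_mod_cube_div (x := imul c - y') (y := - z) fV.
  rewrite scalerBr zE cE /imul scalerN !scalerA ['i%C%:A * _]mulrC.
  by rewrite opprD addrA subrr sub0r.
by exists z'; rewrite -z'E addrC subrK.
Qed.

Section Deformation.
Context {R : realType} (M : smooth_manifold R).
Local Notation C := R[i].
Local Notation smooth_fun := (smooth_fun M).
Local Notation oneform := (oneform M).

(* [symb] is a |-> a mod kappa: as a surjection of C-algebras onto C_c^oo(M)
   with kernel kappa A, it amounts to an isomorphism of C_c^oo(M) with
   A / kappa A. *)
Record smooth_deformation := SmoothDeformation {
  scal : comAlgType C;
  kappa : scal;
  alg : lmodType scal;
  amul : alg -> alg -> alg;
  amulA : forall a b c, amul a (amul b c) = amul (amul a b) c;
  amulDl : forall a b c, amul (a + b) c = amul a c + amul b c;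
  amulDr : forall a b c, amul a (b + c) = amul a b + amul a c;
  amulZl : forall l a b, amul (l *: a) b = l *: amul a b;
  amulZr : forall l a b, amul a (l *: b) = l *: amul a b;
  symb : alg -> smooth_fun;
  symbD : forall a b, symb (a + b) = symb a + symb b;
  symbZ : forall (c : C) a, symb (c%:A *: a) = csmooth_cst M c * symb a;
  symbM : forall a b, symb (amul a b) = symb a * symb b;
  symb_image : forall f, csupp_fun f <-> exists a, symb a = f;
  symb_ker : forall a, symb a = 0 <-> exists b, a = kappa *: b;
  alg_free : free_mod_cube alg kappa }.

Section Bracket.
Variable A : smooth_deformation.
Local Notation kap := (kappa A).

Definition is_pbracket (f g h : smooth_fun) : Prop :=
  csupp_fun h /\
  forall a b c : alg A, symb a = f -> symb b = g -> symb c = h ->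
    exists z, kap *: c = imul (amul a b - amul b a) + kap ^+ 2 *: z.

(* {f, g}; the default value 0 is never used on C_c^oo(M), see [pbracketP] *)
Definition pbracket (f g : smooth_fun) : smooth_fun :=
  xget 0 [set h | is_pbracket f g h].

Lemma symb_eq (a a' : alg A) :
  symb a = symb a' <-> exists u, a = a' + kap *: u.
Proof.
have symbE : symb a = symb (a - a') + symb a' by rewrite -symbD subrK.
split=> [aa'|[u au]]; last first.
  by rewrite symbE (proj2 (symb_ker _)) ?add0r//; exists u; rewrite au addrC addKr.
have /symb_ker[u uE] : symb (a - a') = 0.
  by apply: (addIr (symb a')); rewrite -symbE add0r.
by exists u; rewrite -uE addrC subrK.
Qed.

Lemma pbracketP (f g : smooth_fun) : csupp_fun f -> csupp_fun g ->
  unique (is_pbracket f g) (pbracket f g).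
Proof.
move=> /(symb_image A)[a0 <-] /(symb_image A)[b0 <-].
have [|||||a b|h [[hc hP] hU]] := commutator_bracket (s := @symb A)
    (cm := fun a b : alg A => amul a b - amul b a) (alg_free A) _ symb_eq
    _ _ _ _ _ a0 b0.
- by move=> a a' /symb_eq.
- by move=> a a' x; rewrite amulDl amulDr opprD addrACA.
- by move=> a x x'; rewrite amulDl amulDr opprD addrACA.
- by move=> l a x; rewrite amulZl amulZr scalerBr.
- by move=> l a x; rewrite amulZl amulZr scalerBr.
- have /symb_eq[u uE] : symb (amul a b) = symb (amul b a).
    by rewrite !symbM mulrC.
  by exists u; rewrite uE addrC addKr.
have PE h' : is_pbracket (symb a0) (symb b0) h' -> h' = h.
  by move=> [/(symb_image A) h'c h'P]; apply/esym/hU; split.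
have Ph : is_pbracket (symb a0) (symb b0) h by split=> //; exact/(symb_image A).
by rewrite /pbracket (xget_unique _ Ph PE); split=> // h' /PE.
Qed.

Definition is_poisson_bivector (pi : bivector M) : Prop :=
  poisson pi /\
  forall f g, csupp_fun f -> csupp_fun g -> pbracket f g = bv_bracket pi f g.

(* Deformation of the module [Ec] of compactly supported sections inside the
   module [E] of all smooth sections of a vector bundle; [bsymb] is reduction
   modulo kappa. *)
Record bimodule_deformation (E : lmodType smooth_fun) (Ec : set E) :=
  BimoduleDeformation {
  bimod :> lmodType (scal A);
  lact : alg A -> bimod -> bimod;
  ract : bimod -> alg A -> bimod;
  lactA : forall a b v, lact a (lact b v) = lact (amul a b) v;
  ractA : forall v a b, ract (ract v a) b = ract v (amul a b);
  lractA : forall a v b, ract (lact a v) b = lact a (ract v b);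
  lactDl : forall a b v, lact (a + b) v = lact a v + lact b v;
  lactDr : forall a v w, lact a (v + w) = lact a v + lact a w;
  ractDl : forall v w a, ract (v + w) a = ract v a + ract w a;
  ractDr : forall v a b, ract v (a + b) = ract v a + ract v b;
  lactZl : forall l a v, lact (l *: a) v = l *: lact a v;
  lactZr : forall l a v, lact a (l *: v) = l *: lact a v;
  ractZl : forall l v a, ract (l *: v) a = l *: ract v a;
  ractZr : forall l v a, ract v (l *: a) = l *: ract v a;
  bsymb : bimod -> E;
  bsymbD : forall v w, bsymb (v + w) = bsymb v + bsymb w;
  bsymbZ : forall (c : C) v, bsymb (c%:A *: v) = csmooth_cst M c *: bsymb v;
  bsymb_lact : forall a v, bsymb (lact a v) = symb a *: bsymb v;
  bsymb_ract : forall v a, bsymb (ract v a) = symb a *: bsymb v;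
  bsymb_image : forall e, Ec e <-> exists v, bsymb v = e;
  bsymb_ker : forall v, bsymb v = 0 <-> exists w, v = kappa A *: w;
  bimod_free : free_mod_cube bimod (kappa A) }.

Section GenBracket.
Variables (E : lmodType smooth_fun) (Ec : set E).
Variable V : bimodule_deformation Ec.

Definition is_gbracket (f : smooth_fun) (v w : E) : Prop :=
  Ec w /\
  forall (a : alg A) (x y : V), symb a = f -> bsymb x = v -> bsymb y = w ->
    exists z, kap *: y = imul (lact a x - ract x a) + kap ^+ 2 *: z.

(* {f, v}, see [gbracketP] *)
Definition gbracket (f : smooth_fun) (v : E) : E :=
  xget 0 [set w | is_gbracket f v w].

Lemma bsymb_eq (x x' : V) :
  bsymb x = bsymb x' <-> exists u, x = x' + kap *: u.
Proof.
have bsymbE : bsymb x = bsymb (x - x') + bsymb x' by rewrite -bsymbD subrK.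
split=> [xx'|[u xu]]; last first.
  by rewrite bsymbE (proj2 (bsymb_ker _)) ?add0r//; exists u; rewrite xu addrC addKr.
have /bsymb_ker[u uE] : bsymb (x - x') = 0.
  by apply: (addIr (bsymb x')); rewrite -bsymbE add0r.
by exists u; rewrite -uE addrC subrK.
Qed.

Lemma gbracketP (f : smooth_fun) (v : E) : csupp_fun f -> Ec v ->
  unique (is_gbracket f v) (gbracket f v).
Proof.
move=> /(symb_image A)[a0 <-] /(bsymb_image V)[x0 <-].
have [|||||a x|w [[wc wP] wU]] := commutator_bracket (s := @symb A)
    (t := @bsymb E Ec V)
    (cm := fun (a : alg A) (x : V) => lact a x - ract x a) (bimod_free V) _
    bsymb_eq _ _ _ _ _ a0 x0.
- by move=> a a' /symb_eq.
- by move=> a a' x; rewrite lactDl ractDr opprD addrACA.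
- by move=> a x x'; rewrite lactDr ractDl opprD addrACA.
- by move=> l a x; rewrite lactZl ractZr scalerBr.
- by move=> l a x; rewrite lactZr ractZl scalerBr.
- have /bsymb_eq[u uE] : bsymb (lact a x) = bsymb (ract x a).
    by rewrite bsymb_lact bsymb_ract.
  by exists u; rewrite uE addrC addKr.
have PE w' : is_gbracket (symb a0) (bsymb x0) w' -> w' = w.
  by move=> [/(bsymb_image V) w'c w'P]; apply/esym/wU; split.
have Pw : is_gbracket (symb a0) (bsymb x0) w by split=> //; exact/(bsymb_image V).
by rewrite /gbracket (xget_unique _ Pw PE); split=> // w' /PE.
Qed.

End GenBracket.

Record oneform_deformation := OneformDeformation {
  forms :> bimodule_deformation [set w : oneform | csupp_form w];
  dform : alg A -> forms;
  dformD : forall a b, dform (a + b) = dform a + dform b;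
  dformZ : forall (l : scal A) a, dform (l *: a) = l *: dform a;
  dformM : forall a b,
    dform (amul a b) = ract (dform a) b + lact a (dform b);
  dform_symb : forall a, bsymb (dform a) = grad (symb a) }.

End Bracket.
End Deformation.

(* Main.v *)
(** Taking commutators in A and in Omega^1 modulo kappa^3 turns associativity,
    the bimodule axioms and d(ab) = da b + a db into identities for the brackets:
    {f, _} and {_, s} are derivations, {f, {g, s}} - {g, {f, s}} = {{f, g}, s} and
    {f, dg} - {g, df} = d{f, g}. By Hadamard's lemma a derivation at a point p of
    the compactly supported functions only sees the differential at p, so {f, g}
    and {f, s} depend on f through df alone: this gives the bivector, and the
    connection D by D_s = sum_i e_i {f_i, _} whenever s = sum_i e_i df_i near p,
    with cut-offs reducing everything to compact supports. The Koszul bracket is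
    necessarily D_s r - D_r s, so that torsion vanishes, and the curvature, being
    tensorial, vanishes because it does on exact forms. *)
Require Import Defs.
From HB Require Import structures.
From mathcomp Require Import all_boot all_order all_algebra.
From mathcomp Require Import all_classical all_reals all_analysis.
From mathcomp Require Import complex ring lra.
Set Implicit Arguments.
Unset Strict Implicit.
Unset Printing Implicit Defensive.
Import Order.TTheory GRing.Theory Num.Theory.
Import numFieldNormedType.Exports.
Local Open Scope classical_set_scope.
Local Open Scope ring_scope.

(** * Smooth maps between open sets of R^n *)

Section Smoothness.
Context {R : realType} {n : nat}.
Implicit Types (U V : set 'rV[R]_n).

(** A bracket is a commutator divided by kappa, so an identity between brackets is checked after
    multiplying back the factors removed: one for the Leibniz rules and for d, two for the Jacobi
    identity. Freeness modulo [kappa ^+ 3] is what allows kappa squared to be cancelled, leaving an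
    equality modulo kappa. The analytic obstacle is that brackets are meaningful on compact supports
    only, while [oneform] and the connection allow any support. Constants need not be compactly
    supported, so coordinates, coefficients and constants are all replaced by compactly supported
    functions with the right germ at a point, and each identity is then compared germ by germ.
    Hadamard's lemma integrates along segments, which may leave the image of a chart; functions are
    therefore cut off to all of R^n beforehand. Smoothness of the Hadamard coefficients requires
    differentiation under the integral sign, obtained here from a Taylor bound uniform along the
    segment. *)

Lemma diff_upto_sub (W : normedModType R) k U V (f : 'rV[R]_n -> W) :
  U `<=` V -> diff_upto k V f -> diff_upto k U f.
Proof.
move=> UV; elim: k f => [|k IH] f /= [df sf]; split=> //.
- by move=> x /UV; exact: df.
- by move=> x /UV; exact: df.
- by move=> i; exact: IH (sf i).
Qed.

Lemma diff_upto_local (W : normedModType R) k U (f : 'rV[R]_n -> W) :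
  (forall x, U x -> exists V, V x /\ diff_upto k V f) -> diff_upto k U f.
Proof.
elim: k f => [|k IH] f fU /=.
  by split=> // x /fU[V [Vx [df _]]]; exact: df.
split=> [x /fU[V [Vx [df _]]]|i]; first exact: df.
by apply: IH => x /fU[V [Vx [_ sf]]]; exists V; split=> //; exact: sf.
Qed.

Lemma csmooth_on_sub U V (f : 'rV[R]_n -> R[i]) :
  U `<=` V -> csmooth_on V f -> csmooth_on U f.
Proof. by move=> UV [fr fi]; split=> k; exact: diff_upto_sub (UV) _. Qed.

Lemma csmooth_on_local U (f : 'rV[R]_n -> R[i]) :
  (forall x, U x -> exists V g,
    [/\ open V, V x, {in V, g =1 f} & csmooth_on V g]) -> csmooth_on U f.
Proof.
move=> fU; split=> k; apply: diff_upto_local => x /fU[V [g [oV Vx gf sg]]];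
  by exists V; split=> //; have [sr si] := csmooth_on_eq oV gf sg.
Qed.

Lemma diff_coord (j : 'I_n) (x v : 'rV[R]_n) :
  'd (fun N : 'rV[R]_n => N 0 j : R) x v = v 0 j.
Proof.
have @L : {linear 'rV[R]_n -> R}.
  by exists (fun N : 'rV[R]_n => N 0 j); do 2![eexists]; do ?[constructor];
    rewrite ?mxE// => ? *; rewrite ?mxE//; move=> ?; rewrite !mxE.
rewrite (_ : (fun N : 'rV[R]_n => N 0 j) = L)// diff_lin//.
exact: coord_continuous.
Qed.

Lemma diff_upto_coord k U (t : 'rV[R]_n -> 'rV[R]_n) j : open U ->
  diff_upto k U t -> diff_upto k U (fun x => t x 0 j).
Proof.
move=> oU; elim: k t => [|k IH] t /= [dt st].
  by split=> // x Ux; apply: (differentiable_comp (dt x Ux)) (differentiable_coord _ _ _).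
split=> [x Ux|i].
  by apply: (differentiable_comp (dt x Ux)) (differentiable_coord _ _ _).
apply: (diff_upto_eq oU _ (IH _ (st i))) => x /[!inE] Ux.
rewrite /partial [in RHS]deriveE; last first.
  exact: (differentiable_comp (dt x Ux)) (differentiable_coord _ _ _).
rewrite deriveE; last exact: dt.
rewrite (_ : (fun x0 => t x0 0 j) = (fun N : 'rV[R]_n => N 0 j) \o t)//.
rewrite (diff_comp (dt x Ux) (differentiable_coord _ 0 j)).
by rewrite /= diff_coord.
Qed.

Lemma partial_comp (t : 'rV[R]_n -> 'rV[R]_n) (g : 'rV[R]_n -> R) i x :
  differentiable t x -> differentiable g (t x) ->
  partial i (g \o t) x = \sum_j partial j g (t x) * partial i t x 0 j.
Proof.
move=> dt dg.
rewrite /partial [LHS]deriveE; last exact: differentiable_comp.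
rewrite (diff_comp dt dg)/= -(deriveE _ dt).
rewrite [X in _ X = _]row_sum_delta linear_sum/=; apply: eq_bigr => j _.
by rewrite linearZ/= -deriveE// mulrC.
Qed.

Lemma diff_upto_sum (I : finType) k U (F : I -> 'rV[R]_n -> R) : open U ->
  (forall i, diff_upto k U (F i)) -> diff_upto k U (fun x => \sum_i F i x).
Proof.
move=> oU sF; elim: (index_enum I) => [|i r IH].
  by apply: (diff_upto_eq oU _ (diff_upto_cst oU k 0)) => x _; rewrite big_nil.
by apply: (diff_upto_eq oU _ (diff_uptoD oU (sF i) IH)) => x _; rewrite big_cons.
Qed.

(** The partials of [g \o t] are sums of products of [partial j g \o t] with components of
    [partial i t], so the induction on the order runs over all [g] with [t] fixed. *)
Lemma diff_upto_comp k U V (t : 'rV[R]_n -> 'rV[R]_n) (g : 'rV[R]_n -> R) :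
  open U -> (forall x, U x -> V (t x)) ->
  diff_upto k U t -> diff_upto k V g -> diff_upto k U (g \o t).
Proof.
move=> oU UV; elim: k g => [|k IH] g.
  move=> /= [dt _] [dg _]; split=> // x Ux.
  by apply: differentiable_comp; [exact: dt|apply: dg; exact: UV].
move=> st sg; have [dt pt] := st; have [dg pg] := sg; split=> [x Ux|i].
  by apply: differentiable_comp; [exact: dt|apply: dg; exact: UV].
have := diff_upto_sum oU (fun j => diff_uptoM oU (IH _ (diff_upto_le st) (pg j))
  (diff_upto_coord j oU (pt i))).
apply: diff_upto_eq => // x /[!inE] Ux.
by rewrite partial_comp//; [exact: dt|apply: dg; exact: UV].
Qed.

End Smoothness.

(** * Bump functions *)

Section Bump.
Context {R : realType}.

(* At 0 < x this is x^-m exp(-1/x). Their span is closed under derivation,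
   which gives smoothness of [exp_flat 0] without computing higher derivatives. *)
Definition exp_flat (m : nat) (x : R) : R :=
  if 0 < x then x^-1 ^+ m * expR (- x^-1) else 0.

Lemma exp_flat_le0 m x : x <= 0 -> exp_flat m x = 0.
Proof. by rewrite /exp_flat leNgt; case: ltrP. Qed.

Lemma exp_flat_gt0 m x : 0 < x -> 0 < exp_flat m x.
Proof. by move=> x0; rewrite /exp_flat x0 mulr_gt0 ?expR_gt0// exprn_gt0// invr_gt0. Qed.

Lemma exp_flat_ge0 m x : 0 <= exp_flat m x.
Proof. by have [/exp_flat_le0->//|/exp_flat_gt0/ltW] := leP x 0. Qed.

Lemma exp_flat0_homo : {homo exp_flat 0 : x y / x <= y}.
Proof.
move=> x y xy; have [/(exp_flat_le0 0)->|x0] := leP x 0; first exact: exp_flat_ge0.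
have y0 := lt_le_trans x0 xy.
by rewrite /exp_flat x0 y0 !mul1r ler_expR lerN2 lef_pV2.
Qed.

(** With y = 1/x the bound reads y^(m+1) <= (m+1)^(m+1) exp y, the (m+1)-st power of y/(m+1) <= exp
    (y/(m+1)). It controls the difference quotient at 0. *)
Lemma exp_flat_linear_bound m : exists C : R, 0 <= C /\ forall x, exp_flat m x <= C * `|x|.
Proof.
exists (m.+1%:R ^+ m.+1); split=> [|x]; first exact: exprn_ge0.
have [/(exp_flat_le0 m)->|x0] := leP x 0; first by rewrite mulr_ge0// exprn_ge0.
have y0 : 0 < x^-1 by rewrite invr_gt0.
rewrite /exp_flat x0 gtr0_norm// -[X in _ <= _ * X]invrK; move: (x^-1) y0 => y y0.
rewrite expRN ler_pdivrMr ?expR_gt0// mulrAC ler_pdivlMr// -exprSr.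
have {2}-> : y = m.+1%:R * (y / m.+1%:R) by rewrite mulrC mulfVK.
rewrite expRM_natl -exprMn; apply: lerXn2r; rewrite ?nnegrE ?mulr_ge0 ?expR_ge0 ?(ltW y0)//.
rewrite -ler_pdivrMl// mulrC; apply: le_trans (expR_ge1Dx _).
by rewrite lerDr.
Qed.

Lemma exp_flatS m x : x^-1 * exp_flat m x = exp_flat m.+1 x.
Proof.
by rewrite /exp_flat; case: ifP; rewrite ?mulr0// mulrA -exprS.
Qed.

Lemma is_derive_exp_flat m x :
  is_derive x (1 : R) (exp_flat m) (exp_flat m.+2 x - m%:R * exp_flat m.+1 x).
Proof.
have [x0|x0|->] := ltgtP x 0.
- rewrite !exp_flat_le0 ?ltW// mulr0 subr0.
  apply: (@near_eq_is_derive _ _ _ (fun=> 0)).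
  by near=> y; rewrite exp_flat_le0// ltW//; near: y; exact: lt_nbhsl.
- apply: (@near_eq_is_derive _ _ _ (fun y : R => y^-1 ^+ m * expR (- y^-1))).
    by near=> y; rewrite /exp_flat ifT//; near: y; exact: lt_nbhsr.
  have xn0 : x != 0 by rewrite gt_eqF.
  have dV := is_deriveV (f := id) xn0 (is_derive_id x (1 : R)).
  have dE := is_derive1_comp (is_derive_expR _) (is_deriveN dV).
  have dM := is_deriveM (is_deriveX m dV) dE.
  rewrite (_ : (fun y => _) = (fun y : R => (id y)^-1) ^+ m
      * (@expR R \o (- (fun y : R => (id y)^-1)))); last first.
    by apply/funext => y; rewrite !fctE.
  apply: (is_derive_eq dM).
  rewrite /exp_flat x0 /GRing.scale/= !fctE /=.

  case: (m) => [|k]; rewrite /= ?expr0 ?exprS ?exprVn; field; rewrite ?expf_neq0 ?xn0//.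
- rewrite !exp_flat_le0// mulr0 subr0.
  have [C [C0 CP]] := exp_flat_linear_bound m.+1.
  (* At 0 the difference quotient of [exp_flat m] is [exp_flat m.+1], which the linear bound forces
     to 0. *)
  have L : (fun h : R => h^-1 *: ((exp_flat m \o shift 0) (h *: (1 : R)) - exp_flat m 0))
      @ 0^' --> (0 : R).
    apply/cvgrPdist_le => e e0; near=> h.
    rewrite /= sub0r normrN (exp_flat_le0 m (lexx 0)) subr0 addr0 /GRing.scale/= mulr1 exp_flatS.
    rewrite ger0_norm ?exp_flat_ge0//; apply: le_trans (CP h) _.
    have C1 : 0 < C + 1 by rewrite ltr_wpDl.
    have : `|h| <= e / (C + 1).
      near: h; apply: dnbhs0_le; rewrite divr_gt0// ltr_wpDl//.
    rewrite ler_pdivlMr// => he; apply: le_trans he.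
    by rewrite mulrC ler_wpM2l// lerDl.
  apply: DeriveDef; first by apply: cvgP L.
  exact: cvg_lim L.
Unshelve. all: by end_near.
Qed.

(** One derivative raises the index to [m.+1] and [m.+2], hence an induction on [k] valid for every
    [m]. *)
Lemma diff_upto_exp_flat n k m (U : set 'rV[R]_n) (u : 'rV[R]_n -> R) : open U ->
  diff_upto k U u -> diff_upto k U (exp_flat m \o u).
Proof.
move=> oU; elim: k m => [|k IH] m.
  move=> /= [du _]; split=> // x Ux; apply: differentiable_comp; first exact: du.
  by apply/derivable1_diffP; have [] := is_derive_exp_flat m (u x).
move=> su; have [du pu] := su.
have dfu x : U x -> differentiable (exp_flat m) (u x).
  by move=> Ux; apply/derivable1_diffP; have [] := is_derive_exp_flat m (u x).
split=> [x Ux|i]; first exact: differentiable_comp (du x Ux) (dfu x Ux).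
have su' := diff_upto_le su.
have := diff_uptoM oU (diff_uptoD oU (IH m.+2 su')
  (diff_uptoN oU (diff_uptoM oU (diff_upto_cst oU k (m%:R : R)) (IH m.+1 su')))) (pu i).
apply: diff_upto_eq => // x /[!inE] Ux.
rewrite /partial [RHS]deriveE; last exact: differentiable_comp (du x Ux) (dfu x Ux).
rewrite (diff_comp (du x Ux) (dfu x Ux))/= -(deriveE _ (du x Ux)).
have dE w : 'd (exp_flat m) (u x) w = w * 'D_1 (exp_flat m) (u x).
  rewrite deriveE; last exact: dfu.
  by rewrite -[in LHS](mulr1 w); exact: (linearZ_LR ('d (exp_flat m) (u x)) w (1 : R)).
rewrite dE; have [_ ->] := is_derive_exp_flat m (u x).
by rewrite mulrC.
Qed.

Lemma diff_upto_id n k (U : set 'rV[R]_n) : open U -> diff_upto k U id.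
Proof.
case: k => [|k] oU; split=> // i.
apply: (diff_upto_eq oU _ (diff_upto_cst oU k (delta_mx 0 i))) => x _.
by rewrite /partial derive_id.
Qed.

Lemma smooth_bump n (x0 : 'rV[R]_n) (r : R) : 0 < r ->
  exists b : 'rV[R]_n -> R, [/\ smooth_on setT b, \near x0, b x0 = 1 &
    forall x, r <= `|x - x0| -> b x = 0].
Proof.
move=> r0; pose u (x : 'rV[R]_n) := \sum_i (x 0 i - x0 0 i) * (x 0 i - x0 0 i).
have oT := @openT 'rV[R]_n.
have su k : diff_upto k setT u.
  apply: (diff_upto_sum oT) => i; have sx :=
    diff_uptoD oT (diff_upto_coord i oT (diff_upto_id k oT))
      (diff_upto_cst oT k (- x0 0 i)).
  exact: (diff_uptoM oT sx sx).
(* [exp_flat 0 (u - s)] vanishes for u <= s and is at least c for u >= r ^ 2,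
   so the outer [exp_flat] is constant near x0 and 0 off the ball of radius r. *)
pose s := r ^+ 2 / 2; pose c := exp_flat 0 (r ^+ 2 - s).
have s0 : 0 < s by rewrite divr_gt0// exprn_gt0.
have rs : 0 < r ^+ 2 - s by rewrite /s; have := exprn_gt0 2 r0; lra.
have c0 : 0 < exp_flat 0 c by rewrite !exp_flat_gt0.
exists (fun x => (exp_flat 0 c)^-1 * exp_flat 0 (c - exp_flat 0 (u x - s))); split=> [k||x rx].
- apply: (diff_uptoM oT (diff_upto_cst oT k _)).
  apply: (@diff_upto_exp_flat _ _ 0 _ (fun x => c - exp_flat 0 (u x - s)) oT).
  apply: (diff_uptoD oT (diff_upto_cst oT k _)).
  apply: (diff_uptoN oT).
  apply: (@diff_upto_exp_flat _ _ 0 _ (fun x => u x - s) oT).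
  exact: (diff_uptoD oT (su k) (diff_upto_cst oT k _)).
- have cu : {for x0, continuous u}.
    by apply: differentiable_continuous; have [+ _] := su 0%N; apply.
  have u0 : u x0 = 0 by rewrite /u big1// => i _; rewrite subrr mul0r.
  near=> x; rewrite [exp_flat 0 (u x - s)]exp_flat_le0 ?subr0 ?mulVf ?gt_eqF//.
  rewrite subr_le0; apply: ltW; near: x.
  have us : u x0 < s by rewrite u0.
  exact: (cu [set y | y < s] (lt_nbhsl us)).
- rewrite [exp_flat 0 (c - _)]exp_flat_le0 ?mulr0// subr_le0 exp_flat0_homo// lerB//.
  (* The norm is the maximum norm, so a single coordinate already makes the sum of squares [u x] at
     least r ^ 2. *)
  have [i ri] : exists i, r <= `|x 0 i - x0 0 i|.
    apply: contrapT => /forallNP ri; move: rx; rewrite leNgt => /negP; apply.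
    rewrite -normrN opprB; suff : ball x0 r x by rewrite -ball_normE.
    split=> // i j; rewrite ord1 -ball_normE/= distrC ltNge; exact/negP.
  rewrite /u (bigD1 i)//= -expr2 -[leLHS]addr0 lerD//.
    by rewrite -[leRHS]real_normK ?num_real// lerXn2r ?nnegrE// ltW.
  by apply: sumr_ge0 => j _; rewrite -expr2 sqr_ge0.
Unshelve. all: by end_near.
Qed.

End Bump.

(** * Hadamard's lemma *)

Section UnitIntegral.
Context {R : realType}.
Local Notation mu := (@lebesgue_measure R).
Implicit Types f g : R -> R.

Let D : set R := `[0, 1]%classic.

Definition int01 (f : R -> R) : R := \int[mu]_(t in `[0, 1]) f t.

Let intD f : continuous f -> mu.-integrable D (EFin \o f).
Proof.
move=> cf; apply: continuous_compact_integrable; first exact: segment_compact.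
exact: continuous_subspaceT.
Qed.

Lemma int01_cst (c : R) : int01 (fun=> c) = c.
Proof.
rewrite /int01 Rintegral_cst//= lebesgue_measure_itv/= lte_fin ltr01.
by rewrite -EFinB subr0 mulr1.
Qed.

Lemma int01D f g : continuous f -> continuous g ->
  int01 (fun t => f t + g t) = int01 f + int01 g.
Proof. by move=> cf cg; apply: RintegralD => //; exact: intD. Qed.

Lemma int01Z (c : R) f : continuous f -> int01 (fun t => c * f t) = c * int01 f.
Proof. by move=> cf; apply: RintegralZl => //; exact: intD. Qed.

Lemma eq_int01 f g : (forall t, 0 <= t <= 1 -> f t = g t) -> int01 f = int01 g.
Proof.
by move=> fg; apply: eq_Rintegral => t; rewrite inE/= in_itv/=; exact: fg.
Qed.

Lemma int01_sum (I : finType) (F : I -> R -> R) : (forall i, continuous (F i)) ->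
  int01 (fun t => \sum_i F i t) = \sum_i int01 (F i).
Proof.
move=> cF; rewrite -[RHS](eq_bigr _ (fun i _ => erefl)).
elim: (index_enum I) => [|i r IH].
  by rewrite big_nil -[RHS]int01_cst; apply: eq_int01 => t _; rewrite big_nil.
rewrite big_cons -IH -int01D//; last first.
  move=> t; elim: (r) => [|j s IHs].
    by under [X in continuous_at _ X]eq_fun do rewrite big_nil; exact: cvg_cst.
  under [X in continuous_at _ X]eq_fun do rewrite big_cons.
  exact: cvgD (cF j t) IHs.
by apply: eq_int01 => t _; rewrite big_cons.
Qed.

Lemma ler_norm_int01 f (c : R) : continuous f ->
  (forall t, 0 <= t <= 1 -> `|f t| <= c) -> `|int01 f| <= c.
Proof.
move=> cf fc; apply: le_trans.
  by apply: le_normr_Rintegral => //; exact: intD.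
rewrite -[leRHS]int01_cst; apply: le_Rintegral => //.
- by apply: (intD (f := fun t => `|f t|)) => t; exact: cvg_norm (cf t).
- by apply: (intD (f := fun=> c)) => t; exact: cvg_cst.
Qed.

Lemma int01_FTC f (F : R -> R) : continuous f -> (forall t, is_derive t (1 : R) F (f t)) ->
  int01 f = F 1 - F 0.
Proof.
move=> cf dF; rewrite /int01 /Rintegral (@continuous_FTC2 _ f F)//.
- exact: continuous_subspaceT.
- have dFt t : derivable F t (1 : R) by have [] := dF t.
  have cF t : {for t, continuous F} by apply/differentiable_continuous/derivable1_diffP.
  split=> [t _//||]; first by apply: cvg_at_right_filter; exact: cF.
  by apply: cvg_at_left_filter; exact: cF.
- by move=> t _; rewrite derive1E; have [_ ->] := dF t.
Qed.

End UnitIntegral.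

Section Taylor.
Context {R : realType} {n : nat}.
Implicit Types (g f : 'rV[R]_n -> R) (x y v w : 'rV[R]_n).

Lemma coord_le_norm v i : `|v 0 i| <= `|v|.
Proof.
rewrite [leRHS]mx_normrE.
exact: (le_bigmax 0 (fun ij : 'I_1 * 'I_n => `|v ij.1 ij.2|) (0, i)).
Qed.

Lemma derive_partial g x w : differentiable g x ->
  'D_w g x = \sum_i w 0 i * partial i g x.
Proof.
move=> dg; rewrite [LHS]deriveE// [X in _ X = _]row_sum_delta linear_sum/=.
by apply: eq_bigr => i _; rewrite linearZ/= -deriveE.
Qed.

Lemma is_derive_line g y w (t : R) : differentiable g (y + t *: w) ->
  is_derive t (1 : R) (fun s => g (y + s *: w))
    (\sum_i w 0 i * partial i g (y + t *: w)).
Proof.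
move=> dg; have dgw := @diff_derivable _ _ _ g (y + t *: w) w dg.
have E : (fun h : R => h^-1 *: (((fun s => g (y + s *: w)) \o shift t) (h *: (1 : R))
    - g (y + t *: w))) =
  (fun h : R => h^-1 *: ((g \o shift (y + t *: w)) (h *: w) - g (y + t *: w))).
  apply/funext => h; rewrite /=; congr (_ *: (g _ - _)).
  by rewrite /GRing.scale/= mulr1 -/(GRing.scale _ _) scalerDl addrCA.
apply: DeriveDef; first by rewrite /derivable E.
by rewrite -derive_partial// /derive E.
Qed.

Lemma line_continuous g y w : (forall x, differentiable g x) ->
  continuous (fun s : R => g (y + s *: w)).
Proof.
move=> dg t; apply/differentiable_continuous/derivable1_diffP.
by have [] := is_derive_line (dg (y + t *: w)).
Qed.

Lemma mvt_line g y w : (forall x, differentiable g x) ->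
  exists c : R, 0 <= c <= 1 /\
    g (y + w) - g y = \sum_i w 0 i * partial i g (y + c *: w).
Proof.
move=> dg.
have [c] := MVT ltr01 (fun s _ => is_derive_line (dg (y + s *: w)))
  (continuous_subspaceT (line_continuous dg)).
rewrite in_itv/= => /andP[c0 c1]; rewrite scale1r scale0r addr0 subr0 mulr1 => E.
by exists c; rewrite !ltW.
Qed.

(** The mean value theorem is used twice, for [g] along [w] and for each [partial i g] along
    [c *: w]; the crude constant counts the pairs of indices. *)
Lemma taylor1_bound g y w (C : R) : diff_upto 1 setT g ->
  (forall c i j, 0 <= c <= 1 -> `|partial j (partial i g) (y + c *: w)| <= C) ->
  `|g (y + w) - g y - \sum_i w 0 i * partial i g y| <= (n * n)%:R * C * `|w| ^+ 2.
Proof.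
move=> [dg sg] CP.
have [c [/andP[c0 c1] ->]] := mvt_line y w (fun x => dg x I).
rewrite -sumrB; apply: le_trans (ler_norm_sum _ _ _) _.
apply: le_trans (_ : \sum_(i < n) n%:R * C * `|w| ^+ 2 <= _); last first.
  by rewrite sumr_const card_ord -[leLHS]mulr_natl !mulrA -natrM.
apply: ler_sum => i _.
rewrite -mulrBr normrM expr2 mulrCA mulrA -[leRHS]mulrA ler_pM ?coord_le_norm//.
have [d [/andP[d0 d1] ->]] := mvt_line y (c *: w) (fun x => (sg i).1 x I).
apply: le_trans (ler_norm_sum _ _ _) _.
rewrite -mulrA mulr_natl -[X in _ *+ X]card_ord -sumr_const.
apply: ler_sum => j _; rewrite normrM mulrC ler_pM//.
  by rewrite scalerA CP// mulr_ge0//= mulr_ile1.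
by rewrite mxE normrM (ger0_norm c0) (le_trans _ (coord_le_norm w j)) ?ler_piMl.
Qed.

(** Differentiation in [x] brings out a factor [t]; the weight [t ^+ m] makes this family closed
    under partial derivatives. The Hadamard coefficients of a function are the case m = 0 applied to
    its partials. *)
Definition radial_mean (x0 : 'rV[R]_n) (m : nat) g x : R :=
  int01 (fun t => t ^+ m * g (x0 + t *: (x - x0))).

Lemma radial_continuous x0 m g x : (forall x, differentiable g x) ->
  continuous (fun t : R => t ^+ m * g (x0 + t *: (x - x0))).
Proof.
by move=> dg t; apply: cvgM; [exact: exprn_continuous|exact: line_continuous].
Qed.

End Taylor.

Lemma is_diff_expansion (R : realType) (V W : normedModType R) (f : V -> W)
    (df : {linear V -> W}) x : continuous df ->
  f \o shift x = cst (f x) + df +o_ 0 id ->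
  differentiable f x /\ 'd f x = df :> (V -> W).
Proof.
move=> cdf fE; have dE := diff_unique cdf fE.
by split=> //; apply/diff_locallyP; rewrite dE.
Qed.

Section HadamardLemma.
Context {R : realType} {n : nat}.
Implicit Types (g f : 'rV[R]_n -> R) (x y v w : 'rV[R]_n).

(** A quadratic remainder on the unit ball is little-o, so the candidate [c] is the differential. An
    integral preserves such an explicit bound, unlike a bare little-o. *)
Lemma differentiable_quadratic f x (c : 'I_n -> R) (C : R) :
  (forall v, `|v| <= 1 -> `|f (x + v) - f x - \sum_i v 0 i * c i| <= C * `|v| ^+ 2) ->
  differentiable f x /\ forall i, partial i f x = c i.
Proof.
move=> fC; pose l (v : 'rV[R]_n) := \sum_i v 0 i * c i.
have l_lin : linear l.
  move=> a v w; rewrite /l scaler_sumr -big_split/=; apply: eq_bigr => i _.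
  by rewrite !mxE mulrDl -mulrA.
pose lM := GRing.isLinear.Build _ _ _ _ _ l_lin.
pose L : {linear 'rV[R]_n -> R} := HB.pack l lM.
have cL : continuous L.
  rewrite /L/= /l; apply: continuous_big => [|i _]; first exact: add_continuous.
  by move=> v; apply: continuousM; [exact: coord_continuous|exact: cst_continuous].
have [|df dE] := is_diff_expansion (f := f) (x := x) cL.
  apply/eqaddoP => e e0; have C1 : 0 < `|C| + 1 by rewrite ltr_wpDl.
  have n1 : \forall v \near (0 : 'rV[R]_n), `|v| <= 1 by exact: nbhs0_le.
  have n2 : \forall v \near (0 : 'rV[R]_n), `|v| <= e / (`|C| + 1).
    by apply: nbhs0_le; rewrite divr_gt0.
  apply: filterS2 n1 n2 => v v1 ve.
  rewrite !fctE/= [v + x]addrC opprD addrA.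
  apply: le_trans (fC v v1) _; rewrite expr2 mulrA ler_wpM2r//.
  rewrite ler_pdivlMr// in ve; apply: le_trans ve.
  rewrite mulrC ler_wpM2l// (le_trans (ler_norm C))// lerDl ler01//.
split=> // i; rewrite /partial (deriveE _ df) dE /L/= /l (bigD1 i)//= mxE !eqxx mul1r.
by rewrite big1 ?addr0// => j ji; rewrite mxE (negbTE ji) andbF mul0r.
Qed.

(** Differentiation under the integral sign: the first-order Taylor remainder of [g] is quadratic
    with a constant independent of [t], and integrating it gives a quadratic remainder for the
    mean. *)
Lemma radial_mean_diff x0 m g x : diff_upto 2 setT g ->
  differentiable (radial_mean x0 m g) x /\
  forall i, partial i (radial_mean x0 m g) x = radial_mean x0 m.+1 (partial i g) x.
Proof.
move=> sg; have sg1 := diff_upto_le sg; have [dg sg'] := sg.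
have dg' z : differentiable g z by exact: dg.
have ddg i z : differentiable (partial i g) z by have [+ _] := sg' i; apply.
(* This radius covers every point x0 + t (x - x0) + c t v with t and c in [0, 1] and v of norm at
   most 1. *)
pose rho := `|x - x0| + 1.
have [C [C0 CP]] : exists C, 0 <= C /\ forall z i j, `|z - x0| <= rho ->
    `|partial j (partial i g) z| <= C.
  (* A continuous function dominating all second partials at once; its bound on the compact ball
     serves as [C]. *)
  pose F z := \sum_i \sum_j `|partial j (partial i g) z|.
  have cF : continuous F.
    apply: continuous_big => [|i _]; first exact: add_continuous.
    apply: continuous_big => [|j _]; first exact: add_continuous.
    have cij : continuous (partial j (partial i g)).
      move=> z; apply: differentiable_continuous.
      by have [_ /(_ j)[+ _]] := sg' i; apply.
    by move=> z; exact: cvg_norm (cij z).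
  have cK : compact (closed_ball x0 rho).
    apply: bounded_closed_compact; last exact: closed_ball_closed.
    exists (`|x0| + rho); split=> [|B xB z]; first exact: num_real.
    rewrite closed_ballE ?ltr_wpDl// /closed_ball_/= => zx0.
    apply/ltW/(le_lt_trans _ xB).
    by rewrite -[z](subrK x0) addrC (le_trans (ler_normD _ _))// lerD2l distrC.
  have /compact_bounded[B [_ BP]] := continuous_compact (continuous_subspaceT cF) cK.
  exists `|B + 1|; split=> // z i j zK.
  have : `|F z| <= `|B + 1|.
    apply: BP; first by rewrite (lt_le_trans _ (ler_norm _))// ltrDl.
    exists z => //; rewrite closed_ballE ?ltr_wpDl// /closed_ball_/=.
    by rewrite distrC.
  apply: le_trans; rewrite [leRHS]ger0_norm; last first.
    by apply: sumr_ge0 => ? _; apply: sumr_ge0.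
  apply: (@le_trans _ _ (\sum_j `|partial j (partial i g) z|)).
    by rewrite (bigD1 j) //= lerDl; apply: sumr_ge0.
  rewrite /F [leRHS](bigD1 i) //= lerDl.
  by apply: sumr_ge0 => ? _; apply: sumr_ge0.
apply: (@differentiable_quadratic _ _ _ ((n * n)%:R * C)) => v v1.
(* The Taylor remainder of [g] at x0 + t (x - x0) for the increment t v; weighted by [t ^+ m] it
   integrates to the remainder of the mean. *)
pose Q t := g (x0 + t *: (x - x0) + t *: v) - g (x0 + t *: (x - x0)) -
  \sum_i (t *: v) 0 i * partial i g (x0 + t *: (x - x0)).
have rc i : continuous (fun t : R => t ^+ m.+1 * partial i g (x0 + t *: (x - x0))).
  exact: radial_continuous (ddg i).
pose S t := \sum_i v 0 i * (t ^+ m.+1 * partial i g (x0 + t *: (x - x0))).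
have cS : continuous S.
  apply: continuous_big => [|i _]; first exact: add_continuous.
  move=> t; apply: cvgM; [exact: cvg_cst|exact: rc i t].
have QE t : t ^+ m * Q t = (t ^+ m * g (x0 + t *: (x + v - x0)) -
    t ^+ m * g (x0 + t *: (x - x0))) - S t.
  rewrite /Q !mulrBr; congr (_ * g _ - _ - _).
    by rewrite -addrA -scalerDr addrAC.
  rewrite mulr_sumr; apply: eq_bigr => i _.
  by rewrite mxE exprS; ring.
have cA y : continuous (fun t : R => t ^+ m * g (x0 + t *: (y - x0))).
  exact: radial_continuous dg'.
have cQ : continuous (fun t : R => t ^+ m * Q t).
  rewrite (funext QE) => t.
  by apply: cvgB; [apply: cvgB; exact: cA|exact: cS].
suff -> : radial_mean x0 m g (x + v) - radial_mean x0 m g x -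
    \sum_i v 0 i * radial_mean x0 m.+1 (partial i g) x =
    int01 (fun t => t ^+ m * Q t).
  apply: ler_norm_int01 => // t /andP[t0 t1].
  rewrite normrM -[leRHS]mul1r ler_pM//.
    by rewrite ger0_norm ?exprn_ge0// exprn_ile1.
  apply: le_trans (taylor1_bound (C := C) sg1 _) _.
    move=> c i j /andP[c0 c1]; apply: CP.
    rewrite [X in `|X|]addrC -[x0 + _ + _]addrA addKr scalerA.
    apply: le_trans (ler_normD _ _) _; rewrite !normrZ; apply: lerD.
      by rewrite ger0_norm// ler_piMl.
    by rewrite (ger0_norm c0) (ger0_norm t0) !mulr_ile1// mulr_ge0.
  by rewrite ler_wpM2l ?mulr_ge0// lerXn2r ?nnegrE// normrZ ger0_norm// ler_piMl.
have -> : \sum_i v 0 i * radial_mean x0 m.+1 (partial i g) x = int01 S.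
  rewrite int01_sum; last by move=> i t; apply: cvgM; [exact: cvg_cst|exact: rc i t].
  by apply: eq_bigr => i _; rewrite int01Z//; exact: rc.
have -> : radial_mean x0 m g (x + v) =
    int01 (fun t => t ^+ m * Q t) + int01 S + radial_mean x0 m g x.
  rewrite /radial_mean -!int01D//; last by move=> t; exact: cvgD (cQ t) (cS t).
  by apply: eq_int01 => t _; rewrite QE !subrK.
by rewrite !addrK.
Qed.

Lemma smooth_radial_mean x0 m g :
  smooth_on setT g -> smooth_on setT (radial_mean x0 m g).
Proof.
move=> sg k; elim: k m g sg => [|k IH] m g sg; split=> //.
- by move=> x _; have [] := radial_mean_diff x0 m x (sg 2).
- by move=> x _; have [] := radial_mean_diff x0 m x (sg 2).
move=> i; apply: (diff_upto_eq openT (f := radial_mean x0 m.+1 (partial i g))).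
  by move=> x _; have [_ ->] := radial_mean_diff x0 m x (sg 2).
by apply: IH => l; have [_] := sg l.+1; apply.
Qed.

(** The difference f x - f x0 is the integral over [0, 1] of the derivative of f along the segment
    from x0 to x, whose i-th summand carries the constant factor x_i - x0_i. *)
Lemma hadamard x0 f : smooth_on setT f -> exists h : 'I_n -> 'rV[R]_n -> R,
  [/\ forall i, smooth_on setT (h i), forall i, h i x0 = partial i f x0 &
    forall x, f x = f x0 + \sum_i (x 0 i - x0 0 i) * h i x].
Proof.
move=> sf; have spf i : smooth_on setT (partial i f).
  by move=> l; have [_] := sf l.+1; apply.
have df x : differentiable f x by have [+ _] := sf 0%N; apply.
have dpf i x : differentiable (partial i f) x by have [+ _] := spf i 0%N; apply.
exists (fun i => radial_mean x0 0 (partial i f)); split=> [i|i|x].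
- exact: smooth_radial_mean.
- rewrite -[RHS]int01_cst; apply: eq_int01 => t _.
  by rewrite subrr scaler0 addr0 mul1r.
have dl t := is_derive_line (df (x0 + t *: (x - x0))).
have cl i : continuous (fun t : R => partial i f (x0 + t *: (x - x0))).
  exact: line_continuous (dpf i).
have cS i : continuous (fun t : R => (x - x0) 0 i * partial i f (x0 + t *: (x - x0))).
  by move=> t; apply: cvgM; [exact: cvg_cst|exact: cl].
have := int01_FTC _ dl.
rewrite scale1r scale0r addr0 subrKC int01_sum// => FTC.
rewrite -[LHS](subrKC (f x0)) -FTC; last first.
  by apply: continuous_big => // ; exact: add_continuous.
congr (_ + _); apply: eq_bigr => i _; rewrite int01Z; last exact: cl.
rewrite !mxE; congr (_ * _); apply: eq_int01 => t _.
by rewrite mul1r.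
Qed.


End HadamardLemma.

(** * Cut-offs and local coordinates *)

Section CutOff.
Context {R : realType} {n : nat}.
Local Notation C := R[i].

Lemma csmooth_cutoff (x0 : 'rV[R]_n) (U : set 'rV[R]_n) (g : 'rV[R]_n -> C) :
  open U -> U x0 -> csmooth_on U g ->
  exists (G : 'rV[R]_n -> C) (K : set 'rV[R]_n),
    [/\ csmooth_on setT G, \near x0, G x0 = g x0, compact K, K `<=` U &
        forall x, ~ K x -> G x = 0].
Proof.
move=> oU Ux sg; have /nbhs_ballP[e /= e0 eB] := open_nbhs_nbhs (conj oU Ux).
(* Halving the radius keeps the closed ball [K] inside the open ball contained in [U]. *)
pose r := e / 2.
have r0 : 0 < r by rewrite divr_gt0.
have [b [sb b1 b0]] := smooth_bump x0 r0.
pose K := closed_ball x0 r.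
have KE : K = [set x | `|x - x0| <= r].
  by rewrite /K closed_ballE//; apply/funext => x; rewrite /closed_ball_/= distrC.
have Ke : K `<=` ball x0 e.
  rewrite KE => x /= xr; rewrite -ball_normE/= distrC (le_lt_trans xr)//.
  by rewrite /r ltr_pdivrMr// ltr_pMr// ltr1n.
have cK : closed K by exact: closed_ball_closed.
have kK : compact K.
  apply: bounded_closed_compact => //.
  exists (`|x0| + r); split=> [|B xB z]; first exact: num_real.
  rewrite KE /= => zx0; apply/ltW/(le_lt_trans _ xB).
  by rewrite -[z](subrK x0) addrC (le_trans (ler_normD _ _))// lerD2l.
pose G x := real_complex R (b x) * g x.
have G0 x : ~ K x -> G x = 0.
  rewrite KE /= => /negP; rewrite -ltNge => /ltW/b0 bx.
  by rewrite /G bx rmorph0 mul0r.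
exists G, K; split=> //; last by move=> x /Ke/eB.
  (* [g] is only known to be smooth on [U]: at points of [K] the product is smooth on [U], and the
     open complement of [K] carries the zero function. *)
  apply: csmooth_on_local => x _; have [Kx|Kx] := pselect (K x).
    exists U, G; split=> //; first exact/eB/Ke.
    apply: (csmooth_onM oU) => //.
    split=> k; first by apply: diff_upto_sub (sb k).
    exact: (diff_upto_cst oU k 0).
  exists (~` K), (fun=> 0); split=> //; first exact: closed_openC.
    by move=> y /[!inE] /G0.
  exact/csmooth_on_cst/closed_openC.
by apply: filterS b1 => x bx; rewrite /G bx rmorph1 mul1r.
Qed.

Lemma chadamard (x0 : 'rV[R]_n) (f : 'rV[R]_n -> C) : csmooth_on setT f ->
  exists h : 'I_n -> 'rV[R]_n -> C,
  [/\ forall i, csmooth_on setT (h i), forall i, h i x0 = cpartial i f x0 &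
    forall x, f x = f x0 + \sum_i real_complex R (x 0 i - x0 0 i) * h i x].
Proof.
move=> [/(hadamard x0)[u [su u0 uE]] /(hadamard x0)[v [sv v0 vE]]].
exists (fun i x => Complex (u i x) (v i x)); split=> [i|i|x].
- by split; [exact: su|exact: sv].
- by rewrite u0 v0.
- transitivity (Complex (complex.Re (f x)) (complex.Im (f x))); first by case: (f x).
  rewrite uE vE; transitivity (f x0 + Complex (\sum_i (x 0 i - x0 0 i) * u i x)
      (\sum_i (x 0 i - x0 0 i) * v i x)); first by case: (f x0).
  congr (_ + _); elim/big_rec3: _ => [|i a b c _ <-]; first by [].
  by rewrite /=; congr Complex; rewrite /= ?mul0r ?subr0 ?addr0.
Qed.

End CutOff.

Section Extension.
Context {R : realType} {M : smooth_manifold R}.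
Local Notation n := (mdim M).
Local Notation C := R[i].

Lemma csmooth_on_comp (U V : set 'rV[R]_n) (t : 'rV[R]_n -> 'rV[R]_n) (g : 'rV[R]_n -> C) :
  open U -> (forall x, U x -> V (t x)) -> smooth_on U t -> csmooth_on V g ->
  csmooth_on U (g \o t).
Proof.
move=> oU UV st [gr gi]; split=> k.
  exact: (diff_upto_comp (g := fun x => complex.Re (g x)) oU UV (st k) (gr k)).
exact: (diff_upto_comp (g := fun x => complex.Im (g x)) oU UV (st k) (gi k)).
Qed.

Lemma open_chart_preimage (a : chart M) (O : set M) : open O ->
  open (cran a `&` cinv a @^-1` O).
Proof.
move=> oO; rewrite openE => x [ax Ox]; apply: filterI.
  by apply: open_nbhs_nbhs; split=> //; exact: cran_open.
by apply: (cinv_continuous ax); exact: open_nbhs_nbhs.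
Qed.

Lemma cran_cmap (a : chart M) (p : M) : cdom a p -> cran a (cmap a p).
Proof. by exists p. Qed.

Lemma cdom_cinv (a : chart M) x : cran a x -> cdom a (cinv a x).
Proof. by case=> p ap <-; rewrite cmapK. Qed.

Lemma cinvK (a : chart M) x : cran a x -> cmap a (cinv a x) = x.
Proof. by case=> p ap <-; rewrite cmapK. Qed.

Section Extend.
Variables (a : chart M) (p : M) (W : set M) (V : set 'rV[R]_n) (g : 'rV[R]_n -> C).
Hypotheses (ap : cdom a p) (pW : nbhs p W) (oV : open V) (Vp : V (cmap a p))
  (sg : csmooth_on V g).

(** The cut-off of [g] is pulled back by the chart and extended by 0. Its support lies in the image
    [K'] of a compact set, closed because the manifold is Hausdorff; so in any other chart the
    extension is locally either the cut-off composed with a transition map or zero. *)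
Lemma smooth_extension : exists F : smooth_fun M,
  [/\ csupp_fun F, forall q, F q != 0 -> W q & \near p, F p = g (cmap a p)].
Proof.
set x0 := cmap a p; have ax0 := cran_cmap ap.
pose U := V `&` (cran a `&` cinv a @^-1` W^°).
have oU : open U by apply: openI => //; exact/open_chart_preimage/open_interior.
have Ux0 : U x0 by split=> //; split=> //=; rewrite cmapK.
have sgU : csmooth_on U g by apply: csmooth_on_sub sg => x [].
have [G [K [sG Gg kK KU G0]]] := csmooth_cutoff oU Ux0 sgU.
pose K' := cinv a @` K.
have aK x : K x -> cran a x by move=> /KU[_ []].
have kK' : compact K'.
  apply: continuous_compact kK; apply: continuous_in_subspaceT => x.
  by rewrite inE => /aK; exact: cinv_continuous.
have cK' : closed K' by apply: compact_closed kK'; exact: manifold_hausdorff.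
have K'W : K' `<=` W by move=> _ [x /KU[_ [_ xW] <-]]; exact: interior_subset xW.
pose f (q : M) : C := if pselect (cdom a q) is left _ then G (cmap a q) else 0.
have fE q : cdom a q -> f q = G (cmap a q) by move=> aq; rewrite /f; case: pselect.
have fK q : f q != 0 -> K' q.
  rewrite /f; case: pselect => [aq|_]; last by rewrite eqxx.
  move=> Gq; exists (cmap a q); last exact: cmapK.
  by apply: contrapT => /G0 /eqP; apply/negP.
have sf : f \in @smooth_pred R M.
  apply/smooth_predP => c; apply: csmooth_on_local => x cx.
  have [aq|aq] := pselect (cdom a (cinv c x)).
    exists (cran c `&` cinv c @^-1` cdom a), (G \o (cmap a \o cinv c)); split=> //.
    - exact/open_chart_preimage/cdom_open.
    - by move=> y /[!inE] -[_ ay]; rewrite /= fE.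
    - apply: csmooth_on_comp sG => //; first exact/open_chart_preimage/cdom_open.
      move=> k; apply: diff_upto_sub (@transition_smooth _ M c a k).
      move=> y [cy ay]; exists (cinv c y); last exact: cinvK.
      by split=> //; exact: cdom_cinv.
  exists (cran c `&` cinv c @^-1` ~` K'), (fun=> 0).
  have oK' : open (cran c `&` cinv c @^-1` ~` K').
    exact/open_chart_preimage/closed_openC.
  split=> //.
  - by split=> //= -[y /aK/cdom_cinv ay yx]; apply: aq; rewrite -yx.
  - move=> y /[!inE] -[_ Ky]; apply/esym/eqP; apply: contrapT => /negP fy.
    by apply: Ky; exact: fK.
  - exact: csmooth_on_cst.
exists (SmoothFun sf); split=> [|q /fK/K'W//|].
  apply: (subclosed_compact (@closed_closure _ _) kK').
  by rewrite ((closure_id K').1 cK'); apply: closure_subset => q; exact: fK.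
have Gg' := cmap_continuous ap Gg.
have aN : nbhs p (cdom a) by apply: open_nbhs_nbhs; split=> //; exact: cdom_open.
by apply: filterS2 aN Gg' => q aq /= <-; rewrite fE.
Qed.

End Extend.
End Extension.

(** * Supports, germs and gradients at a point *)

Section Pointwise.
Context {R : realType} {M : smooth_manifold R}.
Local Notation n := (mdim M).
Local Notation C := R[i].
Local Notation smooth_fun := (smooth_fun M).
Local Notation oneform := (oneform M).
Implicit Types (f g : smooth_fun) (p q : M) (a b : chart M).

Lemma compactly_supportedS (P Q : set M) :
  P `<=` Q -> compactly_supported Q -> compactly_supported P.
Proof.
move=> PQ cQ; apply: (subclosed_compact (@closed_closure _ _) cQ).
exact: closure_subset.
Qed.

Lemma smooth_funDE f g p : (f + g) p = f p + g p. Proof. by []. Qed.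

Lemma smooth_funNE f p : (- f) p = - f p. Proof. by []. Qed.

Lemma smooth_funME f g p : (f * g) p = f p * g p. Proof. by []. Qed.

Lemma csupp_funD f g : csupp_fun f -> csupp_fun g -> csupp_fun (f + g).
Proof.
move=> cf cg; rewrite /csupp_fun.
apply: (@compactly_supportedS _ ([set p | f p != 0] `|` [set p | g p != 0])).
  move=> p; rewrite /mkset smooth_funDE => fg.
  have [fp0|] := eqVneq (f p) 0; [right|by left].
  by apply: contraNneq fg => /= gp0; rewrite fp0 gp0 addr0.
by rewrite /compactly_supported closureU; exact: compactU.
Qed.

Lemma csupp_funN f : csupp_fun f -> csupp_fun (- f).
Proof.
apply: compactly_supportedS => q; apply: contraNneq => f0.
by rewrite smooth_funNE f0 oppr0.
Qed.

Lemma csupp_funMl f g : csupp_fun f -> csupp_fun (f * g).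
Proof.
by apply: compactly_supportedS => p; apply: contraNneq => f0; rewrite smooth_funME f0 mul0r.
Qed.

Lemma csupp_funMr f g : csupp_fun g -> csupp_fun (f * g).
Proof. by rewrite mulrC; exact: csupp_funMl. Qed.

Lemma csupp_fun0 : csupp_fun (0 : smooth_fun).
Proof.
rewrite /csupp_fun /compactly_supported (_ : [set p | _] = set0) ?closure0.
  exact: compact0.
by apply/seteqP; split => p //=; rewrite eqxx.
Qed.

Lemma csupp_fun_sum (I : Type) (r : seq I) (F : I -> smooth_fun) :
  (forall i, csupp_fun (F i)) -> csupp_fun (\sum_(i <- r) F i).
Proof.
by move=> cF; apply: big_ind => //; [exact: csupp_fun0|exact: csupp_funD].
Qed.

Lemma csupp_formZl f (w : oneform) : csupp_fun f -> csupp_form (f *: w).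
Proof.
by apply: compactly_supportedS => p /= [a]; apply: contraNneq => ->; rewrite scale0r.
Qed.

Lemma smooth_fun_sumE (I : Type) (r : seq I) (F : I -> smooth_fun) p :
  (\sum_(i <- r) F i) p = \sum_(i <- r) F i p.
Proof.
by elim: r => [|i r IH]; rewrite ?big_nil// !big_cons/= -IH.
Qed.

Lemma formDE (v w : oneform) a p : (v + w) a p = v a p + w a p. Proof. by []. Qed.

Lemma formNE (w : oneform) a p : (- w) a p = - w a p. Proof. by []. Qed.

Lemma formZE f (w : oneform) a p : (f *: w) a p = f p *: w a p. Proof. by []. Qed.

Lemma form_sumE (I : Type) (r : seq I) (F : I -> oneform) a p :
  (\sum_(i <- r) F i) a p = \sum_(i <- r) F i a p.
Proof.
by elim: r => [|i r IH]; rewrite ?big_nil// !big_cons/= -IH.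
Qed.

Lemma smooth_funP f g : (forall p, f p = g p) -> f = g.
Proof. by move=> fg; apply/val_inj/funext. Qed.

Definition form_near (v w : oneform) (p : M) : Prop := \forall q \near p, forall a, v a q = w a q.

Lemma exists_cutoff p (W : set M) : nbhs p W -> exists c : smooth_fun,
  [/\ csupp_fun c, forall q, c q != 0 -> W q & \near p, c p = 1].
Proof.
move=> pW.
exact: smooth_extension (chart_atP p) pW openT I (csmooth_on_cst openT 1).
Qed.

Lemma form_transition (w : oneform) a b p : cdom a p -> cdom b p ->
  w a p = jac a b p *m w b p.
Proof. by have /oneform_predP[_] := form_compP w; apply. Qed.

Lemma form_out (w : oneform) a p : ~ cdom a p -> w a p = 0.
Proof. by have /oneform_predP[[+ _] _] := form_compP w; apply. Qed.

Lemma form_eq_at (v w : oneform) a p : cdom a p -> v a p = w a p ->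
  forall b, v b p = w b p.
Proof.
move=> ap vw b; have [bp|bp] := pselect (cdom b p); last by rewrite !form_out.
by rewrite !(@form_transition _ b a p)// vw.
Qed.

Lemma gradE f a p i : cdom a p ->
  grad f a p i 0 = cpartial i (f \o cinv a) (cmap a p).
Proof. by move=> ap; rewrite /= /grad_comp; case: pselect => // ?; rewrite mxE. Qed.

Lemma near_eq_cpartial (f g : 'rV[R]_n -> C) x i :
  (\near x, f x = g x) -> cpartial i f x = cpartial i g x.
Proof.
move=> fg; rewrite /cpartial /partial; congr Complex; apply: near_eq_derive;
  by apply: filterS fg => y /= ->.
Qed.

Lemma near_chart a p (P : M -> Prop) : cdom a p -> (\near p, P p) ->
  \forall x \near cmap a p, P (cinv a x).
Proof.
by move=> ap Pp; apply: (cinv_continuous (cran_cmap ap)); rewrite cmapK.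
Qed.

Lemma grad_near f g p : (\near p, f p = g p) -> forall a, grad f a p = grad g a p.
Proof.
move=> fg a; have [ap|ap] := pselect (cdom a p); last by rewrite !form_out.
apply/colP => i; rewrite !gradE//; apply: near_eq_cpartial.
exact: near_chart fg.
Qed.

Lemma near_near p (P : M -> Prop) : (\near p, P p) ->
  \forall q \near p, \forall r \near q, P r.
Proof. by move=> Pp; exact: nbhs_interior. Qed.

Lemma grad_cst (c : C) : grad (csmooth_cst M c) = 0.
Proof.
apply/oneformP => a p; have [ap|ap] := pselect (cdom a p); last by rewrite !form_out.
apply/colP => i; rewrite gradE// mxE /cpartial/=.
by rewrite /partial !derive_cst.
Qed.

Lemma csmooth_on_coord (U : set 'rV[R]_n) i : open U ->
  csmooth_on U (fun x : 'rV[R]_n => real_complex R (x 0 i)).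
Proof.
move=> oU; split=> k; last exact: (diff_upto_cst oU k 0).
exact: (diff_upto_coord i oU (diff_upto_id k oU)).
Qed.

Lemma cpartial_coord i j (x : 'rV[R]_n) :
  cpartial i (fun x : 'rV[R]_n => real_complex R (x 0 j)) x = (i == j)%:R.
Proof.
rewrite /cpartial /partial/= derive_cst.
rewrite deriveE; last exact: differentiable_coord.
by rewrite diff_coord mxE eqxx eq_sym; case: eqP.
Qed.

(** The gradients are prescribed on a whole neighbourhood of [p], not just at [p]: smoothness of
    tensors computed from these functions depends on it. *)
Lemma exists_coordinates a p : cdom a p -> exists X : 'I_n -> smooth_fun,
  (forall i, csupp_fun (X i)) /\
  \near p, cdom a p /\ forall i, grad (X i) a p = delta_mx i 0.
Proof.
move=> ap.
have /choice[X XP] : forall i : 'I_n, exists F : smooth_fun, csupp_fun F /\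
    \near p, F p = real_complex R (cmap a p 0 i).
  move=> i; have [F [cF _ FE]] := smooth_extension ap filterT openT I
    (csmooth_on_coord i openT).
  by exists F.
exists X; split=> [i|]; first by have [] := XP i.
have aN : nbhs p (cdom a) by apply: open_nbhs_nbhs; split=> //; exact: cdom_open.
have XN : \near p, forall i, X i p = real_complex R (cmap a p 0 i).
  by apply: filter_forall => i; have [] := XP i.
apply: filterS2 aN (near_near XN) => q aq qN; split=> // i.
apply/colP => k; rewrite gradE// mxE andbT.
rewrite -(cpartial_coord k i (cmap a q)); apply: near_eq_cpartial.
have := near_chart aq qN.
have : \forall x \near cmap a q, cran a x.
  by apply: open_nbhs_nbhs; split; [exact: cran_open|exact: cran_cmap].
by apply: filterS2 => x ax /(_ i) /= ->; rewrite cinvK.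
Qed.

End Pointwise.

(** * Point derivations *)

Section PointDerivation.
Context {R : realType} {M : smooth_manifold R}.
Local Notation n := (mdim M).
Local Notation C := R[i].
Local Notation smooth_fun := (smooth_fun M).
Local Notation oneform := (oneform M).
Implicit Types (f g : smooth_fun) (p q : M) (a b : chart M).

Lemma smooth_fun_derivable f a p i : cdom a p ->
  derivable (fun x => complex.Re (f (cinv a x))) (cmap a p) (delta_mx 0 i) /\
  derivable (fun x => complex.Im (f (cinv a x))) (cmap a p) (delta_mx 0 i).
Proof.
move=> ap; have /smooth_predP/(_ a)[/(_ 0%N)[dr _] /(_ 0%N)[di _]] := smooth_fun_valP f.
by split; apply: diff_derivable; [apply: dr|apply: di]; exact: cran_cmap.
Qed.

Lemma gradD f g : grad (f + g) = grad f + grad g.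
Proof.
apply/oneformP => a p; have [ap|ap] := pselect (cdom a p); last by rewrite !form_out.
apply/colP => i; rewrite gradE// [in RHS]mxE !gradE// /cpartial/partial.
have [fr fi] := smooth_fun_derivable f i ap.
have [gr gi] := smooth_fun_derivable g i ap.
have E1 : (fun x => complex.Re (((f + g)%R \o cinv a) x)) =
    (fun x => complex.Re (f (cinv a x))) + (fun x => complex.Re (g (cinv a x))).
  apply/funext => x; transitivity (complex.Re (f (cinv a x) + g (cinv a x))) => //.
  by rewrite !fctE; case: (f _) (g _) => [? ?] [].
have E2 : (fun x => complex.Im (((f + g)%R \o cinv a) x)) =
    (fun x => complex.Im (f (cinv a x))) + (fun x => complex.Im (g (cinv a x))).
  apply/funext => x; transitivity (complex.Im (f (cinv a x) + g (cinv a x))) => //.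
  by rewrite !fctE; case: (f _) (g _) => [? ?] [].
rewrite E1.
rewrite E2.
rewrite (deriveD fr gr).
rewrite (deriveD fi gi).
by [].
Qed.

(** The left side has the shape in which the real product rule, applied to the real and imaginary
    parts of a product, delivers its terms. *)
Lemma complex_leibniz (u v : C) (a b c d : R) :
  Complex (complex.Re u * a + complex.Re v * b - (complex.Im u * c + complex.Im v * d))
    (complex.Re u * c + complex.Im v * b + (complex.Im u * a + complex.Re v * d)) =
  u * Complex a c + v * Complex b d.
Proof.
by case: u v => [u u'] [v v']; apply/eqP; rewrite eq_complex/=; apply/andP; split;
  apply/eqP; ring.
Qed.

Lemma gradM f g : grad (f * g) = f *: grad g + g *: grad f.
Proof.
apply/oneformP => a p; have [ap|ap] := pselect (cdom a p); last by rewrite !form_out.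
apply/colP => i; rewrite gradE// [in RHS]mxE/= [in RHS]mxE [X in _ = _ + X]mxE.
rewrite !gradE// /cpartial/partial.
have [fr fi] := smooth_fun_derivable f i ap.
have [gr gi] := smooth_fun_derivable g i ap.
have E1 : (fun x => complex.Re (((f * g)%R \o cinv a) x)) =
    (fun x => complex.Re (f (cinv a x))) * (fun x => complex.Re (g (cinv a x)))
    - (fun x => complex.Im (f (cinv a x))) * (fun x => complex.Im (g (cinv a x))).
  apply/funext => x; transitivity (complex.Re (f (cinv a x) * g (cinv a x))) => //.
  by rewrite !fctE; case: (f _) (g _) => [? ?] [].
have E2 : (fun x => complex.Im (((f * g)%R \o cinv a) x)) =
    (fun x => complex.Re (f (cinv a x))) * (fun x => complex.Im (g (cinv a x)))
    + (fun x => complex.Im (f (cinv a x))) * (fun x => complex.Re (g (cinv a x))).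
  apply/funext => x; transitivity (complex.Im (f (cinv a x) * g (cinv a x))) => //.
  by rewrite !fctE; case: (f _) (g _) => [? ?] [].
rewrite E1.
rewrite (deriveB (derivableM fr gr) (derivableM fi gi)).
rewrite (deriveM fr gr) (deriveM fi gi).
rewrite E2.
rewrite (deriveD (derivableM fr gi) (derivableM fi gr)).
rewrite (deriveM fr gi) (deriveM fi gr).
rewrite (cmapK ap).
exact: complex_leibniz.
Qed.

Lemma gradZ (c : C) f : grad (csmooth_cst M c * f) = csmooth_cst M c *: grad f.
Proof. by rewrite gradM grad_cst scaler0 addr0. Qed.

Lemma grad0 : grad (0 : smooth_fun) = 0.
Proof. by apply: (addrI (grad (0 : smooth_fun))); rewrite -gradD !addr0. Qed.

Lemma grad_sum (I : Type) (r : seq I) (F : I -> smooth_fun) :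
  grad (\sum_(i <- r) F i) = \sum_(i <- r) grad (F i).
Proof. by elim: r => [|i r IH]; rewrite ?big_nil ?grad0// !big_cons gradD IH. Qed.

(** All axioms are restricted to compact supports, where the brackets satisfy them; in particular no
    value at the constant 1 is prescribed. *)
Record point_derivation p (T : smooth_fun -> C) : Prop := PointDerivation {
  pd_add : forall f g, csupp_fun f -> csupp_fun g -> T (f + g) = T f + T g;
  pd_scale : forall c f, csupp_fun f -> T (csmooth_cst M c * f) = c * T f;
  pd_mul : forall f g, csupp_fun f -> csupp_fun g ->
    T (f * g) = f p * T g + g p * T f }.

Section Theory.
Variables (p : M) (T : smooth_fun -> C).
Hypothesis dT : point_derivation p T.

Lemma pd0 : T 0 = 0.
Proof.
have c0 := @csupp_fun0 R M.
by apply: (addrI (T 0)); rewrite -(pd_add dT)// !addr0.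
Qed.

Lemma pd_opp f : csupp_fun f -> T (- f) = - T f.
Proof.
move=> cf; have -> : - f = csmooth_cst M (-1) * f.
  by apply: smooth_funP => q; rewrite smooth_funME mulN1r.
by rewrite (pd_scale dT)// mulN1r.
Qed.

Lemma pd_sum (I : Type) (r : seq I) (F : I -> smooth_fun) :
  (forall i, csupp_fun (F i)) -> T (\sum_(i <- r) F i) = \sum_(i <- r) T (F i).
Proof.
move=> cF; elim: r => [|i r IH]; rewrite ?big_nil ?pd0// !big_cons.
by rewrite (pd_add dT) ?IH//; exact: csupp_fun_sum.
Qed.

(** A cut-off [c] supported where [f] vanishes gives c f = 0, and the product rule at [p] reduces T
    (c f) to T f. *)
Lemma pd_near0 f : csupp_fun f -> (\near p, f p = 0) -> T f = 0.
Proof.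
move=> cf f0; have [c [cc cf0 /nbhs_singleton c1]] := exists_cutoff f0.
have fc0 : c * f = 0.
  apply: smooth_funP => q; rewrite smooth_funME.
  have [->|/cf0 ->] := eqVneq (c q) 0; first by rewrite mul0r.
  by rewrite mulr0.
have := pd_mul dT cc cf.
by rewrite fc0 pd0 c1 mul1r (nbhs_singleton f0) mul0r addr0.
Qed.

Lemma pd_near f g : csupp_fun f -> csupp_fun g -> (\near p, f p = g p) -> T f = T g.
Proof.
move=> cf cg fg; apply/eqP; rewrite -subr_eq0 -pd_opp// -(pd_add dT)//; last first.
  exact: csupp_funN.
apply/eqP/pd_near0; first by apply: csupp_funD => //; exact: csupp_funN.
by apply: filterS fg => q fgq; rewrite smooth_funDE fgq smooth_funNE subrr.
Qed.

(** The substitute for derivations killing constants: c * c and c have the same germ at [p], so T c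
    = 2 T c. *)
Lemma pd_cutoff c : csupp_fun c -> (\near p, c p = 1) -> T c = 0.
Proof.
move=> cc c1; have : T (c * c) = T c.
  apply: pd_near => //; first exact: csupp_funMl.
  by apply: filterS c1 => q cq; rewrite smooth_funME cq mul1r.
rewrite (pd_mul dT)// (nbhs_singleton c1) mul1r => /eqP.
by rewrite -subr_eq0 addrK => /eqP.
Qed.

(** By Hadamard, [f] has near [p] the germ of f(p) c plus a sum of products u_i v_i of functions
    vanishing at [p]: u_i is a centred coordinate and v_i(p) a partial derivative of [f]. The
    product rule kills each of these products, and [pd_cutoff] kills the constant part. *)
Lemma pd_jet f a : csupp_fun f -> cdom a p -> grad f a p = 0 -> T f = 0.
Proof.
move=> cf ap gf0; set x0 := cmap a p.
have /smooth_predP/(_ a) sf := smooth_fun_valP f.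
have [G [K [sG Gf _ _ _]]] := csmooth_cutoff (@cran_open _ M a) (cran_cmap ap) sf.
have [h [sh h0 GE]] := chadamard x0 sG.
have Gf0 : G x0 = f p by rewrite (nbhs_singleton Gf)/= cmapK.
have h00 i : h i x0 = 0.
  by rewrite h0 (near_eq_cpartial _ Gf) -gradE// gf0 mxE.
have /choice[u uP] : forall i : 'I_n, exists F : smooth_fun, csupp_fun F /\
    \near p, F p = real_complex R (cmap a p 0 i - x0 0 i).
  move=> i; have sx := csmooth_onD openT (csmooth_on_coord i openT)
    (csmooth_on_cst openT (real_complex R (- x0 0 i))).
  have [F [cF _ FE]] := smooth_extension ap filterT openT I sx.
  by exists F; split=> //; apply: filterS FE => q ->; rewrite rmorphD.
have /choice[v vP] : forall i : 'I_n, exists F : smooth_fun, csupp_fun F /\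
    \near p, F p = h i (cmap a p).
  move=> i; have [F [cF _ FE]] := smooth_extension ap filterT openT I (sh i).
  by exists F.
have [c [cc _ c1]] := @exists_cutoff _ M p setT filterT.
have cuv i : csupp_fun (u i * v i) by apply: csupp_funMl; have [] := uP i.
have -> : T f = T (csmooth_cst M (f p) * c + \sum_i u i * v i).
  apply: pd_near => //.
    by apply: csupp_funD; [exact: csupp_funMr|exact: csupp_fun_sum].
  have uN : \near p, forall i, u i p = real_complex R (cmap a p 0 i - x0 0 i).
    by apply: filter_forall => i; have [] := uP i.
  have vN : \near p, forall i, v i p = h i (cmap a p).
    by apply: filter_forall => i; have [] := vP i.
  have aN : nbhs p (cdom a) by apply: open_nbhs_nbhs; split=> //; exact: cdom_open.
  have GN := cmap_continuous ap Gf.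
  near=> q; have aq : cdom a q by near: q.
  have fq : f q = G (cmap a q).
    by rewrite -[q in LHS](cmapK aq); apply/esym; near: q.
  rewrite fq GE smooth_funDE smooth_funME smooth_fun_sumE Gf0.
  have -> : c q = 1 by near: q.
  rewrite mulr1; congr (_ + _); apply: eq_bigr => i _; rewrite smooth_funME.
  have -> : u i q = real_complex R (cmap a q 0 i - x0 0 i) by move: i; near: q.
  by congr (_ * _); apply/esym; move: i; near: q.
rewrite (pd_add dT) ?(pd_scale dT) ?(pd_cutoff cc c1) ?mulr0 ?add0r//; first last.
- exact: csupp_fun_sum.
- exact: csupp_funMr.
rewrite pd_sum// big1// => i _; have [cu uE] := uP i; have [cv vE] := vP i.
rewrite (pd_mul dT)// (nbhs_singleton uE) (nbhs_singleton vE) h00 subrr.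
by rewrite rmorph0 !mul0r addr0.
Unshelve. all: by end_near. Qed.

(** Subtracting the combination of the X_i with the partials of [f] at [p] as coefficients leaves a
    function of zero gradient, to which [pd_jet] applies. *)
Lemma pd_expand f a (X : 'I_n -> smooth_fun) : csupp_fun f -> cdom a p ->
  (forall i, csupp_fun (X i)) -> (forall i, grad (X i) a p = delta_mx i 0) ->
  T f = \sum_i grad f a p i 0 * T (X i).
Proof.
move=> cf ap cX gX; pose F i := csmooth_cst M (grad f a p i 0) * X i.
have cF i : csupp_fun (F i) by exact: csupp_funMr.
have cS : csupp_fun (\sum_i F i) by exact: csupp_fun_sum.
have : T (f - \sum_i F i) = 0.
  apply: (@pd_jet _ a) => //; first by apply: csupp_funD => //; exact: csupp_funN.
  have gN : grad (- \sum_i F i) = - grad (\sum_i F i).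
    by apply/eqP; rewrite -addr_eq0 -gradD addNr grad0.
  rewrite gradD gN grad_sum; apply/colP => i.
  rewrite formDE formNE form_sumE [LHS]mxE [X in _ + X]mxE summxE mxE.
  rewrite (bigD1 i) // big1 => [|j /andP[_ ji]]; last first.
    by rewrite /F gradZ formZE gX !mxE eq_sym (negbTE ji) mulr0.
  by rewrite Monoid.mulm1 /F gradZ formZE gX !mxE !eqxx mulr1 subrr.
rewrite (pd_add dT) ?pd_opp//; last exact: csupp_funN.
move/eqP; rewrite subr_eq0 => /eqP ->; rewrite pd_sum//.
by apply: eq_bigr => i _; rewrite (pd_scale dT).
Qed.

End Theory.
End PointDerivation.

(** * Identities for the brackets *)

(** Expand [x] in the basis: X^2 c_e is divisible by X^3, so X divides every coordinate c_e. The
    part of [x] in kap^3 E is a multiple of kap anyway. *)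
Lemma free_mod_cube_div2 (C : fieldType) (k : comAlgType C) (E : lmodType k)
    (kap : k) (x : E) : free_mod_cube E kap ->
  kap ^+ 2 *: x = 0 -> exists z, x = kap *: z.
Proof.
move=> [B [span indep]] kx.
have [s [c [t [us sB wE]]]] := span x.
have Xc : forall e, e \in s -> ('X^3 %| 'X^2 * c e)%R.
  apply: (indep s (fun e => 'X^2 * c e) (- (kap ^+ 2 *: t)) us sB).
  apply/eqP; rewrite scalerN -addr_eq0; apply/eqP.
  rewrite -[RHS]kx wE scalerDr scaler_sumr; congr (_ + _).
    by apply: eq_bigr => e _; rewrite rmorphM/= rmorphXn/= horner_algX scalerA.
  by rewrite !scalerA mulrC.
pose q e := (c e %/ 'X)%R.
have cE : forall e, e \in s -> c e = q e * 'X.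
  move=> e /Xc; rewrite exprSr dvdp_mul2l ?expf_neq0 ?polyX_eq0// => ?.
  by rewrite /q divpK.
exists (\sum_(e <- s) horner_alg kap (q e) *: e + kap ^+ 2 *: t).
rewrite [LHS]wE scalerDr scalerA -exprS scaler_sumr; congr (_ + _).
rewrite big_seq [RHS]big_seq; apply: eq_bigr => e es.
by rewrite scalerA cE// rmorphM/= horner_algX mulrC.
Qed.

Section BracketAlgebra.
Context {R : realType} {M : smooth_manifold R} {A : smooth_deformation M}.
Local Notation C := R[i].
Local Notation smooth_fun := (smooth_fun M).
Local Notation kap := (kappa A).

Section Generic.
Context {E : lmodType smooth_fun} {Ec : set E}.
Variable V : bimodule_deformation A Ec.
Definition comm (a : alg A) (x : V) : V := lact a x - ract x a.

Lemma ker_commutator (a : alg A) (x : V) : exists e, comm a x = kap *: e.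
Proof.
have /bsymb_eq[u uE] : bsymb (lact a x) = bsymb (ract x a).
  by rewrite bsymb_lact bsymb_ract.
by exists u; rewrite /comm uE addrC addKr.
Qed.

Lemma ker_commutator_alg (a b : alg A) : exists e, amul a b - amul b a = kap *: e.
Proof.
have /symb_eq[u uE] : symb (amul a b) = symb (amul b a) by rewrite !symbM mulrC.
by exists u; rewrite uE addrC addKr.
Qed.

Lemma csupp_symb (a : alg A) : csupp_fun (symb a).
Proof. by apply/(symb_image A); exists a. Qed.

Lemma Ec_bsymb (x : V) : Ec (bsymb x).
Proof. by apply/(bsymb_image V); exists x. Qed.

Lemma lactBl (a b : alg A) (x : V) : lact (a - b) x = lact a x - lact b x.
Proof. by rewrite -scaleN1r lactDl lactZl scaleN1r. Qed.

Lemma lactBr (a : alg A) (x y : V) : lact a (x - y) = lact a x - lact a y.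
Proof. by rewrite -scaleN1r lactDr lactZr scaleN1r. Qed.

Lemma ractBl (a : alg A) (x y : V) : ract (x - y) a = ract x a - ract y a.
Proof. by rewrite -scaleN1r ractDl ractZl scaleN1r. Qed.

Lemma ractBr (a b : alg A) (x : V) : ract x (a - b) = ract x a - ract x b.
Proof. by rewrite -scaleN1r ractDr ractZr scaleN1r. Qed.

Lemma commutator_jacobi (a b : alg A) (x : V) :
  comm a (comm b x) - comm b (comm a x) = comm (amul a b - amul b a) x.
Proof.
rewrite /comm lactBl ractBr !lactBr !ractBl !lactA !ractA !lractA.
have E2 (p q r s : V) : p - q - (r - s) = (p + s) - (q + r).
  by rewrite opprB addrACA -opprD.
rewrite (E2 _ _ (lact b _) _) (E2 (lact (amul b a) x)).
by rewrite [X in _ - (_ - X)]addrC opprB addrA subrK E2.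
Qed.

(** The computation rule behind all identities below: any quotient [e] of the commutator by kappa
    represents the bracket up to the factor i, because two quotients agree modulo kappa. *)
Lemma gbracketE (a : alg A) (x e : V) : comm a x = kap *: e ->
  gbracket V (symb a) (bsymb x) = bsymb (imul e).
Proof.
move=> eE; have [[Ew wP] _] := gbracketP V (@csupp_symb a) (Ec_bsymb x).
have [y yE] := (bsymb_image V _).1 Ew.
have [z zE] := wP a x y erefl erefl yE; rewrite -yE; apply/bsymb_eq.
have [|u uE] := free_mod_cube_div (x := y - imul e) (y := z) (bimod_free V).
  by rewrite scalerBr zE -/(comm a x) eE /imul !scalerA [_ * kap]mulrC addrAC subrr add0r.
by exists u; rewrite -uE addrC subrK.
Qed.

Lemma gbracket_Ec f v : csupp_fun f -> Ec v -> Ec (gbracket V f v).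
Proof. by move=> cf cv; have [[]] := gbracketP V cf cv. Qed.

Lemma pbracketE (a b e : alg A) : amul a b - amul b a = kap *: e ->
  pbracket A (symb a) (symb b) = symb (imul e).
Proof.
move=> eE; have [[Ew wP] _] := pbracketP A (@csupp_symb a) (@csupp_symb b).
have [y yE] := (symb_image A _).1 Ew.
have [z zE] := wP a b y erefl erefl yE; rewrite -yE; apply/symb_eq.
have [|u uE] := free_mod_cube_div (x := y - imul e) (y := z) (alg_free A).
  by rewrite scalerBr zE eE /imul !scalerA [_ * kap]mulrC addrAC subrr add0r.
by exists u; rewrite -uE addrC subrK.
Qed.

Lemma pbracket_csupp f g : csupp_fun f -> csupp_fun g -> csupp_fun (pbracket A f g).
Proof. by move=> cf cg; have [[]] := pbracketP A cf cg. Qed.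

Lemma pbracket_antisym f g : csupp_fun f -> csupp_fun g ->
  pbracket A f g = - pbracket A g f.
Proof.
move=> /(symb_image A)[a <-] /(symb_image A)[b <-].
have [e eE] := ker_commutator_alg a b; rewrite (pbracketE eE).
have eE' : amul b a - amul a b = kap *: (- e) by rewrite scalerN -eE opprB.
rewrite (pbracketE eE') /imul scalerN.
by apply/eqP; rewrite -subr_eq0 opprK -symbD subrr; apply/eqP/symb_ker;
  exists 0; rewrite scaler0.
Qed.

Lemma gbracketDl f g v : csupp_fun f -> csupp_fun g -> Ec v ->
  gbracket V (f + g) v = gbracket V f v + gbracket V g v.
Proof.
move=> /(symb_image A)[a <-] /(symb_image A)[b <-] /(bsymb_image V)[x <-].
have [e eE] := ker_commutator a x; have [d dE] := ker_commutator b x.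
rewrite -symbD (gbracketE eE) (gbracketE dE) -bsymbD -scalerDr.
by apply: gbracketE; rewrite /comm lactDl ractDr opprD addrACA -!/(comm _ _) eE dE scalerDr.
Qed.

Lemma gbracketZl c f v : csupp_fun f -> Ec v ->
  gbracket V (csmooth_cst M c * f) v = csmooth_cst M c *: gbracket V f v.
Proof.
move=> /(symb_image A)[a <-] /(bsymb_image V)[x <-].
have [e eE] := ker_commutator a x.
rewrite -symbZ (gbracketE eE) -bsymbZ /imul scalerA mulrC -scalerA.
by apply: gbracketE; rewrite /comm lactZl ractZr -scalerBr -/(comm _ _) eE !scalerA mulrC.
Qed.

(** Reduction of [ab, x] = a [b, x] + [a, x] b; the right factor b becomes a left multiplication
    only modulo kappa. *)
Lemma gbracketMl f g v : csupp_fun f -> csupp_fun g -> Ec v ->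
  gbracket V (f * g) v = f *: gbracket V g v + g *: gbracket V f v.
Proof.
move=> /(symb_image A)[a <-] /(symb_image A)[b <-] /(bsymb_image V)[x <-].
have [e eE] := ker_commutator a x; have [d dE] := ker_commutator b x.
rewrite -symbM (gbracketE eE) (gbracketE dE) -bsymb_lact -bsymb_ract -bsymbD.
rewrite /imul lactZr ractZl -scalerDr; apply: gbracketE.
rewrite /comm scalerDr -lactZr -ractZl -eE -dE.
by rewrite lactBr ractBl lactA -ractA lractA addrA subrK.
Qed.

Lemma gbracketDr f v w : csupp_fun f -> Ec v -> Ec w ->
  gbracket V f (v + w) = gbracket V f v + gbracket V f w.
Proof.
move=> /(symb_image A)[a <-] /(bsymb_image V)[x <-] /(bsymb_image V)[y <-].
have [e eE] := ker_commutator a x; have [d dE] := ker_commutator a y.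
rewrite -bsymbD (gbracketE eE) (gbracketE dE) -bsymbD -scalerDr.
by apply: gbracketE; rewrite /comm lactDr ractDl opprD addrACA -!/(comm _ _) eE dE scalerDr.
Qed.

(** Reduction of [a, bx] = [a, b] x + b [a, x]. *)
Lemma gbracketMr f g v : csupp_fun f -> csupp_fun g -> Ec v ->
  gbracket V f (g *: v) = pbracket A f g *: v + g *: gbracket V f v.
Proof.
move=> /(symb_image A)[a <-] /(symb_image A)[b <-] /(bsymb_image V)[x <-].
have [e eE] := ker_commutator_alg a b; have [d dE] := ker_commutator a x.
rewrite -bsymb_lact (pbracketE eE) (gbracketE dE) -!bsymb_lact -bsymbD.
rewrite /imul lactZl lactZr -scalerDr; apply: gbracketE.
rewrite /comm scalerDr -lactZl -lactZr -eE -dE.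
by rewrite lactBl lactBr !lactA lractA addrA subrK.
Qed.

Lemma gbracket_jacobi f g v : csupp_fun f -> csupp_fun g -> Ec v ->
  gbracket V f (gbracket V g v) - gbracket V g (gbracket V f v) =
  gbracket V (pbracket A f g) v.
Proof.
move=> /(symb_image A)[a <-] /(symb_image A)[b <-] /(bsymb_image V)[x <-].
have [e eE] := ker_commutator_alg a b.
have [d dE] := ker_commutator a x; have [d' d'E] := ker_commutator b d.
have [c cE] := ker_commutator b x; have [c' c'E] := ker_commutator a c.
have [u uE] := ker_commutator e x.
have commZr (k : alg A) (l : scal A) (y : V) : comm k (l *: y) = l *: comm k y.
  by rewrite /comm lactZr ractZl scalerBr.
have commZl (k : alg A) (l : scal A) (y : V) : comm (l *: k) y = l *: comm k y.
  by rewrite /comm lactZl ractZr scalerBr.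
have iE (k : alg A) (y z : V) : comm k y = kap *: z -> comm k (imul y) = kap *: imul z.
  by move=> yz; rewrite /imul commZr yz !scalerA mulrC.
rewrite (gbracketE dE) (gbracketE cE) (pbracketE eE).
rewrite (gbracketE (iE _ _ _ d'E)) (gbracketE (iE _ _ _ c'E)).
have uE' : comm (imul e) x = kap *: imul u.
  by rewrite /imul commZl uE !scalerA mulrC.
rewrite (gbracketE uE').
suff [z zE] : exists z, c' - d' - u = kap *: z.
  apply/eqP; rewrite subr_eq -bsymbD; apply/eqP/bsymb_eq.
  (* Each double bracket carries i twice, and so does the witness. *)
  exists (imul (imul z)).
  have iK (y : V) : kap *: imul y = imul (kap *: y) by rewrite /imul !scalerA mulrC.
  rewrite !iK -zE -!scalerDr; congr (_ *: (_ *: _)).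
  by rewrite [RHS]addrC addrA !subrK.
(* Multiplication by kappa squared restores the iterated commutators, for which the Jacobi identity
   is exact. *)
apply: (free_mod_cube_div2 (bimod_free V)).
rewrite expr2 -scalerA !scalerBr -c'E -d'E -uE -(commZr a) -(commZr b) -cE -dE.
by rewrite commutator_jacobi eE commZl subrr.
Qed.

End Generic.
End BracketAlgebra.

(** * The Poisson bracket and its action on 1-forms *)

Section Brackets.
Context {R : realType} {M : smooth_manifold R} (A : smooth_deformation M).
Local Notation n := (mdim M).
Local Notation C := R[i].
Local Notation smooth_fun := (smooth_fun M).
Local Notation oneform := (oneform M).
Local Notation P := (pbracket A).

(* The algebra is a deformation of the trivial line bundle, so that the
   identities for [gbracket] specialize to [pbracket]. *)
Definition alg_bimodule :
  bimodule_deformation A [set f : smooth_fun^o | csupp_fun (f : smooth_fun)].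
Proof.
apply: (@BimoduleDeformation _ _ A smooth_fun^o [set f | csupp_fun (f : smooth_fun)]
  (alg A) (@amul _ _ A) (@amul _ _ A) _ _ _ _ _ _ _ _ _ _ _ (@symb _ _ A)).
- by move=> a b v; rewrite amulA.
- by move=> v a b; rewrite amulA.
- by move=> a v b; rewrite amulA.
- exact: amulDl.
- exact: amulDr.
- exact: amulDl.
- by move=> v a b; exact: amulDr.
- exact: amulZl.
- by move=> l a v; exact: amulZr.
- exact: amulZl.
- by move=> l v a; exact: amulZr.
- exact: symbD.
- exact: symbZ.
- exact: symbM.
- by move=> v a; rewrite symbM mulrC.
- exact: symb_image.
- exact: symb_ker.
- exact: alg_free.
(* Transparent, so that [gbracket alg_bimodule] is convertible to [pbracket A]. *)
Defined.

Section Poisson.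
Variables f g h : smooth_fun.
Hypotheses (cf : csupp_fun f) (cg : csupp_fun g) (ch : csupp_fun h).

Lemma pbracketDl : P (f + g) h = P f h + P g h.
Proof. exact: (gbracketDl alg_bimodule). Qed.

Lemma pbracketZl c : P (csmooth_cst M c * f) h = csmooth_cst M c * P f h.
Proof. exact: (gbracketZl alg_bimodule). Qed.

Lemma pbracketMl : P (f * g) h = f * P g h + g * P f h.
Proof. exact: (gbracketMl alg_bimodule). Qed.

Lemma pbracket_jacobi : P f (P g h) - P g (P f h) = P (P f g) h.
Proof. exact: (gbracket_jacobi alg_bimodule). Qed.

End Poisson.

Lemma pbracketNr f g : csupp_fun f -> csupp_fun g -> P f (- g) = - P f g.
Proof.
move=> cf cg; rewrite (pbracket_antisym cf (csupp_funN cg)).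
rewrite (_ : - g = csmooth_cst M (-1) * g); last first.
  by apply: smooth_funP => q; rewrite smooth_funME smooth_funNE mulN1r.
rewrite pbracketZl// [in RHS]pbracket_antisym//; congr (- _).
by apply: smooth_funP => q; rewrite smooth_funME smooth_funNE mulN1r.
Qed.

Lemma pd_pbracket f p : csupp_fun f -> point_derivation p (fun g => P g f p).
Proof.
move=> cf; split=> [g h cg ch|c g cg|g h cg ch].
- by rewrite pbracketDl.
- by rewrite pbracketZl.
- by rewrite pbracketMl.
Qed.

(** The bracket is a point derivation in its first argument, and by antisymmetry in its second;
    [pd_expand] is applied to each in turn. *)
Lemma pbracket_expand f g a p (X : 'I_n -> smooth_fun) :
  csupp_fun f -> csupp_fun g -> cdom a p ->
  (forall i, csupp_fun (X i)) -> (forall i, grad (X i) a p = delta_mx i 0) ->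
  P f g p = \sum_i \sum_j grad f a p i 0 * (P (X i) (X j) p * grad g a p j 0).
Proof.
move=> cf cg ap cX gX; rewrite (pd_expand (pd_pbracket p cg) cf ap cX gX).
apply: eq_bigr => i _; rewrite -mulr_sumr; congr (_ * _).
rewrite pbracket_antisym// smooth_funNE.
rewrite (pd_expand (pd_pbracket p (cX i)) cg ap cX gX) -sumrN.
by apply: eq_bigr => j _; rewrite pbracket_antisym// smooth_funNE mulrN opprK mulrC.
Qed.

Section Forms.
Variable Omega : oneform_deformation A.
Local Notation gb := (gbracket Omega).

Lemma csupp_grad (f : smooth_fun) : csupp_fun f -> csupp_form (grad f).
Proof.
by move=> /(symb_image A)[a <-]; rewrite -(dform_symb Omega); exact: Ec_bsymb.
Qed.

(** Applying d to the commutator gives d(ab - ba) = [a, db] - [b, da]; dividing by kappa and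
    reducing yields the claim. Vanishing of torsion rests on this identity. *)
Lemma gbracket_grad f g : csupp_fun f -> csupp_fun g ->
  gb f (grad g) - gb g (grad f) = grad (P f g).
Proof.
move=> /(symb_image A)[a <-] /(symb_image A)[b <-].
have [e eE] := ker_commutator a (dform Omega b).
have [c cE] := ker_commutator b (dform Omega a).
have [u uE] := ker_commutator_alg a b.
rewrite -!(dform_symb Omega) (gbracketE eE) (gbracketE cE) (pbracketE uE).
rewrite -(dform_symb Omega) dformZ.
have BN (x : Omega) : bsymb (- x) = - bsymb x.
  apply/eqP; rewrite -addr_eq0 -bsymbD addNr; apply/eqP/bsymb_ker.
  by exists 0; rewrite scaler0.
rewrite -BN -bsymbD; apply/bsymb_eq.
have [|z zE] := free_mod_cube_div (x := e - c - dform Omega u) (y := 0)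
    (bimod_free Omega).
  rewrite scaler0 !scalerBr -eE -cE -dformZ -uE /comm.
  have dN (x : alg A) : dform Omega (- x) = - dform Omega x.
    by rewrite -scaleN1r dformZ scaleN1r.
  rewrite dformD dN !dformM.
  by rewrite [- (lact b _ - _)]opprB [X in X - _]addrACA -opprD [_ + ract (_ a) b]addrC subrr.
exists (imul z).
rewrite /imul scalerA [kappa A * _]mulrC -scalerA -zE -scalerBr -scalerDr.
by rewrite [in RHS]addrC subrK.
Qed.

Lemma pd_gbracket (s : oneform) a p i : csupp_form s ->
  point_derivation p (fun f => gb f s a p i 0).
Proof.
move=> cs; split=> [f g cf cg|c f cf|f g cf cg].
- by rewrite gbracketDl// formDE mxE.
- by rewrite gbracketZl// formZE mxE.
- by rewrite gbracketMl// formDE !formZE !mxE.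
Qed.

Lemma gbracketDr_at f (v w : oneform) a p : csupp_fun f -> csupp_form v -> csupp_form w ->
  gb f (v + w) a p = gb f v a p + gb f w a p.
Proof. by move=> cf cv cw; rewrite gbracketDr. Qed.

Lemma gbracketMr_at f g (v : oneform) a p : csupp_fun f -> csupp_fun g -> csupp_form v ->
  gb f (g *: v) a p = P f g p *: v a p + g p *: gb f v a p.
Proof. by move=> cf cg cv; rewrite gbracketMr. Qed.

(** If the cut-off [c] is supported where v = w, then c v = c w. Expanding {f, c v} and {f, c w} at
    [p], the terms {f, c} v and {f, c} w agree there and cancel. *)
Lemma gbracket_near f (v w : oneform) a p : csupp_fun f -> csupp_form v -> csupp_form w ->
  form_near v w p -> gb f v a p = gb f w a p.
Proof.
move=> cf cv cw vw; have [c [cc c0 c1]] := exists_cutoff vw.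
have cvw : c *: v = c *: w.
  apply/oneformP => b q; rewrite !formZE.
  by have [->|/c0->//] := eqVneq (c q) 0; rewrite !scale0r.
have := congr1 (fun s : oneform => s a p) (erefl (gb f (c *: v))).
rewrite {2}cvw !gbracketMr// !formDE !formZE (nbhs_singleton c1) !scale1r.
by rewrite (nbhs_singleton vw) => /addrI.
Qed.

End Forms.
End Brackets.

(** * The Poisson bivector *)

Section PoissonBivector.
Context {R : realType} {M : smooth_manifold R} (A : smooth_deformation M).
Local Notation n := (mdim M).
Local Notation C := R[i].
Local Notation smooth_fun := (smooth_fun M).
Local Notation oneform := (oneform M).
Local Notation P := (pbracket A).

Definition local_coord (a : chart M) (p : M) : 'I_n -> smooth_fun :=
  if pselect (cdom a p) is left ap then projT1 (cid (exists_coordinates ap))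
  else fun=> 0.

Lemma coordP (a : chart M) (p : M) : cdom a p ->
  (forall i, csupp_fun (local_coord a p i)) /\
  \forall q \near p, cdom a q /\ forall i, grad (local_coord a p i) a q = delta_mx i 0.
Proof. by move=> ap; rewrite /local_coord; case: pselect => // ?; case: cid. Qed.

Lemma csupp_coord (a : chart M) (p : M) i : cdom a p -> csupp_fun (local_coord a p i).
Proof. by move=> /coordP[]. Qed.
Arguments csupp_coord {a p} i _.

Lemma grad_coord (a : chart M) (p : M) i : cdom a p ->
  grad (local_coord a p i) a p = delta_mx i 0.
Proof. by move=> /coordP[_ /nbhs_singleton[]]. Qed.
Arguments grad_coord {a p} i _.

Lemma smooth_in_local (a : chart M) (F : M -> C) :
  (forall p, cdom a p -> exists g : smooth_fun, \forall q \near p, F q = g q) ->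
  smooth_in a F.
Proof.
move=> FG; apply: csmooth_on_local => _ [p ap <-].
have [g Fg] := FG p ap; have := near_chart ap Fg.
have aN : nbhs (cmap a p) (cran a).
  by apply: open_nbhs_nbhs; split; [exact: cran_open|exact: cran_cmap].
move=> gN; exists (interior ((fun x => F (cinv a x) = g (cinv a x)) `&` cran a)),
  (g \o cinv a); split.
- exact: open_interior.
- exact: filterI.
- by move=> x /[!inE] /interior_subset[/= ->].
- have /smooth_predP/(_ a) := smooth_fun_valP g; apply: csmooth_on_sub.
  by move=> x /interior_subset[].
Qed.

(** The coordinate functions are chosen anew at each [p], with no regularity in [p]; only the value
    of their bracket at [p] is used, and [pbracket_tensor] shows that it does not depend on the
    choice. *)
Definition poisson_tensor (a : chart M) (p : M) : 'M[C]_n :=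
  if pselect (cdom a p) is left _
  then \matrix_(i, j) P (local_coord a p i) (local_coord a p j) p else 0.

Lemma poisson_tensorE (a : chart M) (p : M) i j : cdom a p ->
  poisson_tensor a p i j = P (local_coord a p i) (local_coord a p j) p.
Proof. by move=> ap; rewrite /poisson_tensor; case: pselect => // ?; rewrite mxE. Qed.

Lemma bilinear_mxE (m : nat) (u : 'cV[C]_m) (B : 'M[C]_m) (v : 'cV[C]_m) :
  (u^T *m B *m v) 0 0 = \sum_i \sum_j u i 0 * (B i j * v j 0).
Proof.
rewrite -mulmxA mxE; apply: eq_bigr => i _; rewrite !mxE mulr_sumr.
by apply: eq_bigr.
Qed.

Lemma bilinear_delta (m : nat) (B : 'M[C]_m) i j :
  ((delta_mx i 0 : 'cV[C]_m)^T *m B *m (delta_mx j 0 : 'cV[C]_m)) 0 0 = B i j.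
Proof. by rewrite trmx_delta -rowE -colE !mxE. Qed.

Lemma pbracket_tensor f g (a : chart M) (p : M) :
  csupp_fun f -> csupp_fun g -> cdom a p ->
  P f g p = ((grad f a p)^T *m poisson_tensor a p *m grad g a p) 0 0.
Proof.
move=> cf cg ap; rewrite bilinear_mxE.
rewrite (pbracket_expand A cf cg ap (csupp_coord ^~ ap) (grad_coord ^~ ap)).
by apply: eq_bigr => i _; apply: eq_bigr => j _; rewrite poisson_tensorE.
Qed.

Lemma poisson_tensor_antisym (a : chart M) (p : M) :
  (poisson_tensor a p)^T = - poisson_tensor a p.
Proof.
have [ap|ap] := pselect (cdom a p); last first.
  by rewrite /poisson_tensor; case: pselect => // _; rewrite trmx0 oppr0.
apply/matrixP => i j; rewrite mxE [RHS]mxE !poisson_tensorE// pbracket_antisym//;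
  exact: csupp_coord.
Qed.

(** Near [p] the coordinates chosen at [p] still have constant gradients, so the entries coincide
    there with the fixed smooth functions {x_i, x_j}. *)
Lemma poisson_tensor_smooth : smooth_components poisson_tensor.
Proof.
split=> [a p ap|a i j]; first by rewrite /poisson_tensor; case: pselect.
apply: smooth_in_local => p ap; exists (P (local_coord a p i) (local_coord a p j)).
have [cX gX] := coordP ap; apply: filterS gX => q [aq gX].
by rewrite (pbracket_tensor (cX i) (cX j) aq) !gX bilinear_delta.
Qed.

Lemma poisson_tensor_transition (a b : chart M) (p : M) : cdom a p -> cdom b p ->
  poisson_tensor b p = (jac a b p)^T *m poisson_tensor a p *m jac a b p.
Proof.
move=> ap bp; apply/matrixP => i j; rewrite poisson_tensorE//.
rewrite (pbracket_tensor (csupp_coord i bp) (csupp_coord j bp) ap).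
rewrite !(form_transition _ ap bp) !grad_coord// trmx_mul !mulmxA.
by rewrite -[_ *m _ *m poisson_tensor a p]mulmxA -[_ *m _ *m jac a b p]mulmxA bilinear_delta.
Qed.

Definition poisson_bivector : bivector M :=
  Bivector poisson_tensor_antisym poisson_tensor_smooth poisson_tensor_transition.

Lemma pairingE (X : vector_field M) (w : oneform) (a : chart M) (p : M) :
  cdom a p -> pairing X w p = (X a p *m w a p) 0 0.
Proof.
move=> ap; have cp := chart_atP p.
rewrite [LHS]/= (form_transition w cp ap) mulmxA.
by rewrite -vf_transition.
Qed.

Lemma lieE (pi : bivector M) (s : oneform) g (a : chart M) (p : M) : cdom a p ->
  lie (sharp pi s) g p = ((s a p)^T *m pi a p *m grad g a p) 0 0.
Proof. by move=> ap; rewrite /lie (pairingE _ _ ap). Qed.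

Lemma bivectorP (pi pi' : bivector M) : (forall a p, cdom a p -> pi a p = pi' a p) ->
  pi = pi'.
Proof.
move=> E; have {}E : bv_comp pi = bv_comp pi'.
  apply/funext => a; apply/funext => p; have [/E//|ap] := pselect (cdom a p).
  by rewrite !(proj1 (bv_smooth _)).
case: pi pi' E => [c as_ sm tr] [c' as' sm' tr'] /= E; move: as' sm' tr'.
rewrite -E => as' sm' tr'; congr Bivector; exact: Prop_irrelevance.
Qed.

Lemma bv_bracketE f g : csupp_fun f -> csupp_fun g ->
  bv_bracket poisson_bivector f g = P f g.
Proof.
move=> cf cg; apply: smooth_funP => p; have cp := chart_atP p.
by rewrite (lieE _ _ _ cp) (pbracket_tensor cf cg cp).
Qed.

Lemma bv_bracket_near (pi : bivector M) (f f' g g' : smooth_fun) (p : M) :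
  (\forall q \near p, f q = f' q) -> (\forall q \near p, g q = g' q) ->
  \forall q \near p, bv_bracket pi f g q = bv_bracket pi f' g' q.
Proof.
move=> ff gg; apply: filterS2 (near_near ff) (near_near gg) => q fq gq.
have cp := chart_atP q.
by rewrite !(lieE _ _ _ cp) (grad_near fq) (grad_near gq).
Qed.

Lemma near_cutoff (c f : smooth_fun) (p : M) : (\forall q \near p, c q = 1) ->
  \forall q \near p, f q = (c * f) q.
Proof. by apply: filterS => q c1; rewrite smooth_funME c1 mul1r. Qed.

Lemma poisson_bivectorP : is_poisson_bivector A poisson_bivector.
Proof.
split=> [f g h|f g cf cg]; last by rewrite bv_bracketE.
apply: smooth_funP => p; have [c [cc _ c1]] := @exists_cutoff _ M p setT filterT.
pose f' := c * f; pose g' := c * g; pose h' := c * h.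
have cf : csupp_fun f' by exact: csupp_funMl.
have cg : csupp_fun g' by exact: csupp_funMl.
have ch : csupp_fun h' by exact: csupp_funMl.
have nf := near_cutoff f c1; have ng := near_cutoff g c1; have nh := near_cutoff h c1.
rewrite !smooth_funDE.
rewrite (nbhs_singleton (bv_bracket_near _ nf (bv_bracket_near _ ng nh))).
rewrite (nbhs_singleton (bv_bracket_near _ ng (bv_bracket_near _ nh nf))).
rewrite (nbhs_singleton (bv_bracket_near _ nh (bv_bracket_near _ nf ng))).
rewrite -!smooth_funDE; congr (smooth_fun_val _ p).
rewrite !bv_bracketE//; do ?exact: pbracket_csupp.
(* Antisymmetry turns the cyclic sum into the derivation form of the Jacobi identity. *)
rewrite [P h' f']pbracket_antisym// pbracketNr//; last exact: pbracket_csupp.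
rewrite [P h' (P f' g')]pbracket_antisym//; last exact: pbracket_csupp.
by rewrite -pbracket_jacobi// subrr.
Qed.

Lemma poisson_bivector_unique : unique (is_poisson_bivector A) poisson_bivector.
Proof.
split=> [|pi [_ piP]]; first exact: poisson_bivectorP.
apply: bivectorP => a p ap; apply/matrixP => i j.
have ci := csupp_coord i ap; have cj := csupp_coord j ap.
have := congr1 (fun f : smooth_fun => f p) (piP _ _ ci cj).
rewrite -bv_bracketE// !(lieE _ _ _ ap) !grad_coord// !bilinear_delta.
by [].
Qed.

End PoissonBivector.

Arguments csupp_coord {R M a p} i _.
Arguments grad_coord {R M a p} i _.

(** * The contravariant connection *)

Section Connection.
Context {R : realType} {M : smooth_manifold R} {A : smooth_deformation M}
  (Omega : oneform_deformation A).
Local Notation n := (mdim M).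
Local Notation C := R[i].
Local Notation smooth_fun := (smooth_fun M).
Local Notation oneform := (oneform M).
Local Notation P := (pbracket A).
Local Notation gb := (gbracket Omega).
Local Notation pi := (poisson_bivector A).

Definition cutoff (p : M) : smooth_fun :=
  projT1 (cid (@exists_cutoff _ M p setT filterT)).

Lemma csupp_cutoff (p : M) : csupp_fun (cutoff p).
Proof. by rewrite /cutoff; case: cid => c []. Qed.

Lemma cutoff1 (p : M) : \forall q \near p, cutoff p q = 1.
Proof. by rewrite /cutoff; case: cid => c []. Qed.

Lemma form_near_cutoff (c : smooth_fun) (v : oneform) (p : M) :
  (\forall q \near p, c q = 1) -> form_near v (c *: v) p.
Proof. by apply: filterS => q cq a; rewrite formZE cq scale1r. Qed.

Lemma gbracket_expand f (s : oneform) (a b : chart M) (p : M) :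
  csupp_fun f -> csupp_form s -> cdom a p ->
  gb f s b p = \sum_i grad f a p i 0 *: gb (local_coord a p i) s b p.
Proof.
move=> cf cs ap; apply/colP => k; rewrite summxE.
rewrite (pd_expand (pd_gbracket Omega b p k cs) cf ap (csupp_coord ^~ ap)
  (grad_coord ^~ ap)).
by apply: eq_bigr => i _; rewrite mxE.
Qed.

(** The form [s] is read in the chart chosen at [p], the result in [b]. The cut-off of [v] puts the
    second argument of the bracket in its domain. *)
Definition conn_comp (s v : oneform) (b : chart M) (p : M) : 'cV[C]_n :=
  \sum_i s (chart_at p) p i 0 *:
    gb (local_coord (chart_at p) p i) (cutoff p *: v) b p.

(* Independence of the coordinates and cut-off chosen in [conn_comp]. *)
Lemma conn_compE (I : finType) (e : I -> C) (f : I -> smooth_fun) (s v w : oneform)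
    (a b : chart M) (p : M) :
  (forall i, csupp_fun (f i)) -> csupp_form w -> cdom a p ->
  s a p = \sum_i e i *: grad (f i) a p -> form_near v w p ->
  conn_comp s v b p = \sum_i e i *: gb (f i) w b p.
Proof.
move=> cf cw ap sE vw; set a0 := chart_at p; have a0p := chart_atP p.
have {ap}sE : s a0 p = \sum_i e i *: grad (f i) a0 p.
  rewrite (form_transition s a0p ap) sE mulmx_sumr; apply: eq_bigr => i _.
  by rewrite -scalemxAr -form_transition.
have nw : form_near (cutoff p *: v) w p.
  apply: filterS2 (form_near_cutoff v (cutoff1 p)) vw => q vq vwq c.
  by rewrite -vq.
have ccv : csupp_form (cutoff p *: v) by apply: csupp_formZl; exact: csupp_cutoff.
rewrite /conn_comp -/a0.
under eq_bigr => j _ do rewrite (gbracket_near Omega b (csupp_coord j a0p) ccv cw nw).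
(* Each bracket with [f i] only sees the gradient of [f i] at [p], so both sides become combinations
   of brackets with the chosen coordinates. *)
under [RHS]eq_bigr => i _ do rewrite (gbracket_expand b (cf i) cw a0p) scaler_sumr.
rewrite exchange_big; apply: eq_bigr => j _; rewrite sE summxE scaler_suml.
by apply: eq_bigr => i _; rewrite scalerA mxE.
Qed.

Lemma form_local_expansion (s : oneform) (p : M) :
  exists (e f : 'I_n -> smooth_fun),
    [/\ forall i, csupp_fun (e i), forall i, csupp_fun (f i) &
        form_near s (\sum_i e i *: grad (f i)) p].
Proof.
set a := chart_at p; have ap := chart_atP p.
have [cX gX] := coordP ap.
have /oneform_predP[[_ ss] _] := form_compP s.
have /choice[e eP] : forall i : 'I_n, exists F : smooth_fun, csupp_fun F /\
    \forall q \near p, F q = s a (cinv a (cmap a q)) i 0.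
  move=> i; have [F [cF _ FE]] := smooth_extension ap filterT
    (@cran_open _ M a) (cran_cmap ap) (ss a i 0).
  by exists F.
have eN : \forall q \near p, forall i, e i q = s a (cinv a (cmap a q)) i 0.
  by apply: filter_forall => i; have [] := eP i.
exists e, (local_coord a p); split=> [i|//|]; first by have [] := eP i.
apply: filterS2 gX eN => q [aq gX] eq; apply: (form_eq_at aq).
rewrite form_sumE; apply/colP => j; rewrite summxE (bigD1 j) // big1 => [|i /andP[_ ij]].
  by rewrite Monoid.mulm1 formZE gX eq cmapK// !mxE !eqxx mulr1.
by rewrite formZE gX !mxE eq_sym (negbTE ij) mulr0.
Qed.

(** Smoothness, the transition rule and vanishing outside the chart are all local conditions,
    inherited from the local 1-forms. *)
Lemma glue_form (T : chart M -> M -> 'cV[C]_n) :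
  (forall p : M, exists w : oneform, \forall q \near p, forall a, T a q = w a q) ->
  T \in @oneform_pred R M.
Proof.
move=> Tw; apply/oneform_predP; split; [split=> [a p ap|a i j]|move=> a b p ap bp].
- by have [w /nbhs_singleton ->] := Tw p; rewrite form_out.
- apply: csmooth_on_local => _ [p ap <-].
  have [w wE] := Tw p; have := near_chart ap wE.
  have aN : nbhs (cmap a p) (cran a).
    by apply: open_nbhs_nbhs; split; [exact: cran_open|exact: cran_cmap].
  move=> wN; exists (interior ((fun x => forall c, T c (cinv a x) = w c (cinv a x))
    `&` cran a)), ((fun q => w a q i j) \o cinv a); split.
  + exact: open_interior.
  + exact: filterI.
  + by move=> x /[!inE] /interior_subset[/= ->].
  + have /oneform_predP[[_ ss] _] := form_compP w; apply: csmooth_on_sub (ss a i j).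
    by move=> x /interior_subset[].
- by have [w /nbhs_singleton wE] := Tw p; rewrite !wE; exact: form_transition.
Qed.

(** [conn_comp] makes new choices at every point, but near [p] it equals one smooth form built from
    an expansion of [s] and a cut-off fixed at [p]. *)
Lemma conn_subproof (s v : oneform) : conn_comp s v \in @oneform_pred R M.
Proof.
apply: glue_form => p; have [e [f [ce cf sE]]] := form_local_expansion s p.
exists (\sum_i e i *: gb (f i) (cutoff p *: v)).
have nv := near_near (form_near_cutoff v (cutoff1 p)).
apply: filterS2 sE nv => q sq nq b.
rewrite (conn_compE (e := fun i => e i q) (w := cutoff p *: v) b cf _ (chart_atP q) _ nq).
- by rewrite form_sumE; apply: eq_bigr => i _; rewrite formZE.
- by apply: csupp_formZl; exact: csupp_cutoff.
- by rewrite sq form_sumE; apply: eq_bigr => i _; rewrite formZE.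
Qed.

Definition conn (s v : oneform) : oneform := OneForm (conn_subproof s v).

Lemma connE (s v : oneform) b (p : M) : conn s v b p = conn_comp s v b p.
Proof. by []. Qed.

Lemma conn_grad (f g : smooth_fun) (v w : oneform) b (p : M) :
  csupp_fun g -> csupp_form w -> (\forall q \near p, f q = g q) -> form_near v w p ->
  conn (grad f) v b p = gb g w b p.
Proof.
move=> cg cw fg vw; rewrite connE.
(* An exact form is its own expansion, with one term of coefficient 1. *)
rewrite (@conn_compE unit (fun=> 1) (fun=> g) _ _ w (chart_at p))//.
- by rewrite big_const card_unit/= addr0 scale1r.
- exact: chart_atP.
- by rewrite (grad_near fg) big_const card_unit/= addr0 scale1r.
Qed.

Lemma conn_gbracket f (s : oneform) : csupp_fun f -> csupp_form s ->
  conn (grad f) s = gb f s.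
Proof.
move=> cf cs; apply/oneformP => b p; apply: conn_grad => //; near=> q => //.
Unshelve. all: by end_near. Qed.

Lemma connDl (s r v : oneform) : conn (s + r) v = conn s v + conn r v.
Proof.
apply/oneformP => b p; rewrite formDE !connE -big_split; apply: eq_bigr => i _.
by rewrite formDE mxE scalerDl.
Qed.

Lemma connZl (f : smooth_fun) (s v : oneform) : conn (f *: s) v = f *: conn s v.
Proof.
apply/oneformP => b p; rewrite formZE !connE scaler_sumr; apply: eq_bigr => i _.
by rewrite formZE mxE scalerA.
Qed.

Lemma connDr (s v w : oneform) : conn s (v + w) = conn s v + conn s w.
Proof.
apply/oneformP => b p; rewrite formDE !connE -big_split; apply: eq_bigr => i _.
have cc : csupp_fun (cutoff p) by exact: csupp_cutoff; have ci := csupp_coord i (chart_atP p).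
have cv : csupp_form (cutoff p *: v) by exact: csupp_formZl.
have cw : csupp_form (cutoff p *: w) by exact: csupp_formZl.
rewrite scalerDr gbracketDr_at//; first exact: scalerDr.
exact/csupp_coord/chart_atP.
Qed.

Lemma connMr (s : oneform) (f : smooth_fun) (v : oneform) :
  conn s (f *: v) = lie (sharp pi s) f *: v + f *: conn s v.
Proof.
apply/oneformP => b p; rewrite formDE !formZE !connE.
set a := chart_at p; have ap := chart_atP p; have cc : csupp_fun (cutoff p) by exact: csupp_cutoff.
pose f' := cutoff p * f; have cf : csupp_fun f' by exact: csupp_funMl.
have cv : csupp_form (cutoff p *: v) by exact: csupp_formZl.
have nf := near_cutoff f (cutoff1 p).
(* The product [f *: v] is replaced by a product of separately cut-off factors, so that the Leibniz
   rule for brackets applies. *)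
rewrite (@conn_compE _ (fun i => s a p i 0) (local_coord a p) s _ (f' *: (cutoff p *: v)) a)//.
- have -> : lie (sharp pi s) f p = \sum_i s a p i 0 * P (local_coord a p i) f' p.
    rewrite (lieE _ _ _ ap) (grad_near nf) bilinear_mxE; apply: eq_bigr => i _.
    rewrite -mulr_sumr; congr (_ * _).
    rewrite (pbracket_tensor A (csupp_coord i ap) cf ap) grad_coord//.
    by rewrite trmx_delta -rowE mxE; apply: eq_bigr => j _; rewrite mxE.
  rewrite /conn_comp -/a scaler_suml scaler_sumr -big_split; apply: eq_bigr => i _.
  rewrite gbracketMr_at//; last exact: csupp_coord.
  rewrite formZE (nbhs_singleton (cutoff1 p)) scale1r scalerDr !scalerA.
  congr (_ + _ *: _); rewrite mulrC; congr (_ * _).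
  by rewrite smooth_funME (nbhs_singleton (cutoff1 p)) mul1r.
- by move=> i; exact: csupp_coord i ap.
- exact: csupp_formZl.
- apply/colP => j; rewrite summxE (bigD1 j) // big1 => [|i /andP[_ ij]].
    by rewrite Monoid.mulm1 grad_coord// !mxE !eqxx mulr1.
  by rewrite grad_coord// !mxE eq_sym (negbTE ij) mulr0.
- apply: filterS2 nf (cutoff1 p) => q fq cq c.
  by rewrite !formZE -fq cq scale1r.
Qed.

End Connection.

(** * Uniqueness, flatness and vanishing torsion *)

Section FlatTorsionFree.
Context {R : realType} {M : smooth_manifold R} {A : smooth_deformation M}
  (Omega : oneform_deformation A).
Local Notation n := (mdim M).
Local Notation C := R[i].
Local Notation smooth_fun := (smooth_fun M).
Local Notation oneform := (oneform M).
Local Notation P := (pbracket A).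
Local Notation gb := (gbracket Omega).
Local Notation pi := (poisson_bivector A).
Local Notation D := (conn Omega).

(* Near any point a 1-form is a function-linear combination of exact ones. *)
Lemma tensor_exact (K : oneform -> oneform) :
  (forall s r, K (s + r) = K s + K r) -> (forall f s, K (f *: s) = f *: K s) ->
  (forall f, csupp_fun f -> K (grad f) = 0) -> forall s, K s = 0.
Proof.
move=> KD KZ Kgrad s; apply/oneformP => a p.
have [e [f [ce cf sE]]] := form_local_expansion s p.
have [c [cc c0 c1]] := exists_cutoff sE.
have csE : c *: s = c *: \sum_i e i *: grad (f i).
  apply/oneformP => b q; rewrite !formZE.
  by have [->|/c0->//] := eqVneq (c q) 0; rewrite !scale0r.
have K0 : K 0 = 0 by apply: (addrI (K 0)); rewrite -KD !addr0.
have Ksum : K (\sum_i e i *: grad (f i)) = 0.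
  rewrite (big_morph K KD K0) big1// => i _.
  by rewrite KZ Kgrad// scaler0.
(* Function-linearity localizes: K (c s) = c K s has the value of K s at [p], while c s is globally
   a multiple of a sum of exact terms. *)
have := congr1 (fun w : oneform => w a p) (KZ c s).
by rewrite csE KZ Ksum scaler0 formZE (nbhs_singleton c1) scale1r => <-.
Qed.

Lemma connNl s v : D (- s) v = - D s v.
Proof.
apply/eqP; rewrite -addr_eq0 -connDl addNr; apply/eqP.
by apply: (addrI (D 0 v)); rewrite -connDl !addr0.
Qed.

Lemma lie_cst (X : vector_field M) c : lie X (csmooth_cst M c) = 0.
Proof.
apply: smooth_funP => p; have ap := chart_atP p.
by rewrite /lie (pairingE _ _ ap) grad_cst mulmx0 mxE.
Qed.

Lemma conn_contravariant : contravariant_connection pi D.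
Proof.
split; [exact: connDl| |exact: connZl|exact: connMr].
move=> s; split=> [u v|c v|f g v]; first exact: connDr.
  by rewrite connMr lie_cst scale0r add0r.
(* The commutator of [D s] with [f] is multiplication by a function, which commutes with [g]. *)
rewrite (connMr Omega s f (g *: v)) addrK (connMr Omega s f v) scalerDr !scalerA.
by rewrite !(mulrC g) opprD addrA subrr add0r addNr.
Qed.

(** The difference D' - D is function-linear in the form. On an exact form the two agree on the
    cut-off section c v, and their equal Leibniz terms cancel, leaving agreement on [v] where c =
    1. *)
Lemma conn_unique (D' : oneform -> oneform -> oneform) :
  contravariant_connection pi D' ->
  (forall f s, csupp_fun f -> csupp_form s -> D' (grad f) s = gb f s) -> D = D'.
Proof.
move=> [D'D _ D'Z D'M] D'gb; apply/funext => s; apply/funext => v; apply/esym/eqP.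
rewrite -subr_eq0; apply/eqP; move: s; apply: tensor_exact.
- by move=> s r; rewrite D'D connDl opprD addrACA.
- by move=> f s; rewrite D'Z connZl scalerBr.
move=> f cf; apply/oneformP => a p.
have [c [cc _ c1]] := @exists_cutoff _ M p setT filterT.
have cv : csupp_form (c *: v) by exact: csupp_formZl.
have := D'gb f _ cf cv; rewrite -conn_gbracket// D'M connMr => /addrI.
move=> /(congr1 (fun w : oneform => w a p)).
by rewrite !formZE (nbhs_singleton c1) !scale1r formDE formNE => ->; rewrite subrr.
Qed.

Definition koszul (s r : oneform) : oneform := D s r - D r s.

Lemma koszul_grad f g : koszul (grad f) (grad g) = grad (bv_bracket pi f g).
Proof.
apply/oneformP => a p; have [c [cc _ c1]] := @exists_cutoff _ M p setT filterT.
have cf : csupp_fun (c * f) by exact: csupp_funMl.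
have cg : csupp_fun (c * g) by exact: csupp_funMl.
have nf := near_cutoff f c1; have ng := near_cutoff g c1.
have ngrad (h k : smooth_fun) : (\forall q \near p, h q = k q) ->
    form_near (grad h) (grad k) p.
  by move=> /near_near; apply: filterS => q hk b; exact: grad_near.
have cgf := csupp_grad Omega cf; have cgg := csupp_grad Omega cg.
rewrite formDE formNE (conn_grad Omega a cf cgg nf (ngrad _ _ ng)).
rewrite (conn_grad Omega a cg cgf ng (ngrad _ _ nf)) -formNE -formDE.
rewrite gbracket_grad//; apply/esym/grad_near.
by rewrite -bv_bracketE//; exact: bv_bracket_near.
Qed.

Lemma koszulP : koszul_bracket pi koszul.
Proof.
split.
- by move=> s r; rewrite /koszul opprB.
- by move=> s r t; rewrite /koszul connDr connDl opprD addrACA.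
- exact: koszul_grad.
- by move=> s f r; rewrite /koszul connMr connZl scalerBr addrA.
Qed.

(** Two Koszul brackets have the same derivative term, so their difference is function-linear in
    each argument; being zero on pairs of exact forms, it vanishes. *)
Lemma koszul_unique : unique (koszul_bracket pi) koszul.
Proof.
split=> [|br [brN brD brgrad brM]]; first exact: koszulP.
have [kN kD kgrad kM] := koszulP.
pose K r s := br s r - koszul s r.
have KN r s : K r s = - K s r.
  by rewrite /K (brN s r) (kN s r) -opprD.
have KD r s t : K (r + t) s = K r s + K t s.
  by rewrite /K brD kD opprD addrACA.
have KM r f s : K (f *: r) s = f *: K r s.
  by rewrite /K brM kM opprD addrACA subrr add0r; exact/esym/scalerBr.
suff K0 s : K s = fun=> 0.
  apply/funext => s; apply/funext => r; apply/esym/eqP; rewrite -subr_eq0.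
  by rewrite -[_ - _]/(K r s) K0.
apply/funext => r; move: s; apply: tensor_exact => [s t|f s|f cf]; first exact: KD.
  exact: KM.
rewrite KN; apply/eqP; rewrite oppr_eq0; apply/eqP; move: r.
apply: tensor_exact => [s t|g s|g cg]; first exact: KD.
  exact: KM.
by rewrite /K brgrad kgrad subrr.
Qed.

(** On the compactly supported section c v this is the Jacobi identity for the action on forms. The
    factor [c] can then be pulled out of the curvature, by the Jacobi identity for functions, and
    removed where it is 1. *)
Lemma curvature_exact (f g : smooth_fun) (v : oneform) : csupp_fun f -> csupp_fun g ->
  curvature koszul D (grad f) (grad g) v = 0.
Proof.
move=> cf cg; apply/oneformP => a p.
have [c [cc _ c1]] := @exists_cutoff _ M p setT filterT.
have cv : csupp_form (c *: v) by exact: csupp_formZl.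
have cfg : csupp_fun (P f g) by exact: pbracket_csupp.
have K0 : curvature koszul D (grad f) (grad g) (c *: v) = 0.
  rewrite /curvature koszul_grad bv_bracketE// !conn_gbracket//.
  - by rewrite gbracket_jacobi// subrr.
  - exact: (gbracket_Ec Omega).
  - exact: (gbracket_Ec Omega).
have lieP h : csupp_fun h -> lie (sharp pi (grad h)) c = P h c.
  by move=> ch; rewrite -bv_bracketE.
have lieP' h k : csupp_fun h -> csupp_fun k -> lie (sharp pi (grad h)) (P k c) = P h (P k c).
  by move=> ch ck; rewrite -(bv_bracketE A ch (pbracket_csupp ck cc)).
have KM : curvature koszul D (grad f) (grad g) (c *: v) =
    c *: curvature koszul D (grad f) (grad g) v.
  rewrite /curvature koszul_grad bv_bracketE//.
  rewrite !connMr !lieP// !connDr !connMr !lieP'// !lieP//.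
  rewrite -(pbracket_jacobi A cf cg cc) scalerBl !scalerBr.
  rewrite !opprD opprK !addrA.
  (* The pairs are the iterated brackets of [c] and the mixed terms in which one derivative falls on
     [c]; the survivors 4, 8 and 11 make up c times the curvature. *)
  rewrite [LHS](ACl ((1*9)*(2*7)*(3*6)*(10*5)*4*8*11)) /=.
  by rewrite !subrr !add0r.
move: K0; rewrite KM => /(congr1 (fun w : oneform => w a p)).
by rewrite formZE (nbhs_singleton c1) scale1r.
Qed.

Lemma conn_flat : flat koszul D.
Proof.
have [kN kD _ kM] := koszulP.
pose K v r s := curvature koszul D s r v.
have KN v r s : K v r s = - K v s r.
  by rewrite /K /curvature (kN s r) connNl opprD !opprK opprB.
have KD v r s t : K v (s + t) r = K v s r + K v t r.
  rewrite /K /curvature kD !connDl connDr !opprD !addrA.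
  by rewrite [LHS](ACl (1*3*5*6*2*4*7*8)).
have KM v f r s : K v (f *: r) s = f *: K v r s.
  rewrite /K /curvature connZl connMr kM connDl !connZl !scalerBr opprD !addrA.
  (* The Leibniz term of [D s] on [f *: D r v] cancels the derivative term of the Koszul bracket of
     [s] with [f *: r]. *)
  rewrite [LHS](ACl ((1*4)*2*3*5)) /=.
  by rewrite subrr add0r.
suff K0 v r s : K v s r = 0 by move=> s r v; exact: (K0 v s r).
(* Linearity is known in one slot; antisymmetry transfers it to the other, reducing both arguments
   to exact forms. *)
move: s; apply: tensor_exact => [s t|f s|f cf]; first exact: KD.
  exact: KM.
rewrite KN; apply/eqP; rewrite oppr_eq0; apply/eqP; move: r.
apply: tensor_exact => [s t|g s|g cg]; first exact: KD.
  exact: KM.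
exact: curvature_exact.
Qed.

Lemma conn_torsion_free : torsion_free koszul D.
Proof. by move=> s r; rewrite /torsion subrr. Qed.

End FlatTorsionFree.

Theorem theorem3 (R : realType) (M : smooth_manifold R)
    (A : smooth_deformation M) (Omega : oneform_deformation A) :
  exists (pi : bivector M)
         (koszul : oneform M -> oneform M -> oneform M)
         (D : oneform M -> oneform M -> oneform M),
    unique (is_poisson_bivector A) pi /\
    unique (koszul_bracket pi) koszul /\
    unique (fun D' : oneform M -> oneform M -> oneform M =>
      contravariant_connection pi D' /\
      forall (f : smooth_fun M) (s : oneform M),
        csupp_fun f -> csupp_form s ->
        D' (grad f) s = gbracket Omega f s) D /\
    flat koszul D /\
    torsion_free koszul D.
Proof.
exists (poisson_bivector A), (koszul Omega), (conn Omega).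
split; first exact: poisson_bivector_unique.
split; first exact: koszul_unique.
split; last by split; [exact: conn_flat|exact: conn_torsion_free].
split=> [|D' [cD' D'gb]]; last exact: conn_unique.
by split=> [|f s cf cs]; [exact: conn_contravariant|exact: conn_gbracket].
Qed.
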